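(* A computable equivalence structure $\mathcal{A}$ is computably bi-embeddably categorical if and only if it has finitely many infinite equivalence classes and bounded character.
   Context: An equivalence structure $\mathcal{A}=(A,E)$ has universe $A\subseteq\omega$ and an equivalence relation $E$ on $A$; it is computable if its atomic diagram is computable. Two structures are bi-embeddable if each embeds into the other; a structure bi-embeddable with $\mathcal{A}$ is a bi-embeddable copy of $\mathcal{A}$. A computable structure $\mathcal{A}$ is computably bi-embeddably categorical if every computable bi-embeddable copy $\mathcal{B}$ of $\mathcal{A}$ is bi-embeddable with $\mathcal{A}$ via computable embeddings (a computable embedding $\mathcal{A}\hookrightarrow\mathcal{B}$ and a computable embedding $\mathcal{B}\hookrightarrow\mathcal{A}$). $\mathcal{A}$ has bounded character if there is a finite $k$ such that all finite equivalence classes of $\mathcal{A}$ have size at most $k$. *)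

(* Defs.v *)
From Stdlib Require Import List Arith.
Import ListNotations.

Inductive rec_code : Type :=
| RZero : rec_code
| RSucc : rec_code
| RProj : nat -> rec_code
| RComp : rec_code -> list rec_code -> rec_code
| RPrec : rec_code -> rec_code -> rec_code
| RMin  : rec_code -> rec_code.

Inductive eval : rec_code -> list nat -> nat -> Prop :=
| ev_zero : forall v, eval RZero v 0
| ev_succ : forall x v, eval RSucc (x :: v) (S x)
| ev_proj : forall i v, i < length v -> eval (RProj i) v (nth i v 0)
| ev_comp : forall f gs v zs y,
    Forall2 (fun g z => eval g v z) gs zs ->
    eval f zs y -> eval (RComp f gs) v y
| ev_prec0 : forall f g v y, eval f v y -> eval (RPrec f g) (0 :: v) y
| ev_precS : forall f g n v r y,
    eval (RPrec f g) (n :: v) r ->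
    eval g (n :: r :: v) y -> eval (RPrec f g) (S n :: v) y
| ev_min : forall f v n,
    eval f (n :: v) 0 ->
    (forall m, m < n -> exists k, eval f (m :: v) (S k)) ->
    eval (RMin f) v n.

Definition computable1 (f : nat -> nat) : Prop :=
  exists c, forall x, eval c [x] (f x).
Definition computable2 (f : nat -> nat -> nat) : Prop :=
  exists c, forall x y, eval c [x; y] (f x y).

Record structure := Struct { dom : nat -> Prop; rel : nat -> nat -> Prop }.

Definition is_equivalence_structure (S : structure) : Prop :=
  (forall x, dom S x -> rel S x x) /\
  (forall x y, dom S x -> dom S y -> rel S x y -> rel S y x) /\
  (forall x y z, dom S x -> dom S y -> dom S z ->
     rel S x y -> rel S y z -> rel S x z).

Definition computable_structure (S : structure) : Prop :=
  (exists d, computable1 d /\ forall x, dom S x <-> d x = 1) /\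
  (exists e, computable2 e /\
     forall x y, dom S x -> dom S y -> (rel S x y <-> e x y = 1)).

Definition is_embedding (S T : structure) (f : nat -> nat) : Prop :=
  (forall x, dom S x -> dom T (f x)) /\
  (forall x y, dom S x -> dom S y -> f x = f y -> x = y) /\
  (forall x y, dom S x -> dom S y -> (rel S x y <-> rel T (f x) (f y))).

Definition embeds (S T : structure) : Prop := exists f, is_embedding S T f.
Definition computably_embeds (S T : structure) : Prop :=
  exists f, computable1 f /\ is_embedding S T f.

Definition bi_embeddable (S T : structure) : Prop := embeds S T /\ embeds T S.
Definition computably_bi_embeddable (S T : structure) : Prop :=
  computably_embeds S T /\ computably_embeds T S.

Definition computably_bi_embeddably_categorical (S : structure) : Prop :=
  forall T, computable_structure T -> is_equivalence_structure T ->
    bi_embeddable S T -> computably_bi_embeddable S T.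

Definition eclass (S : structure) (x : nat) (y : nat) : Prop :=
  dom S y /\ rel S x y.

Definition finite_class (S : structure) (x : nat) : Prop :=
  exists l : list nat, forall y, eclass S x y -> In y l.

Definition class_size_le (S : structure) (x k : nat) : Prop :=
  exists l : list nat, length l <= k /\ forall y, eclass S x y -> In y l.

Definition bounded_character (S : structure) : Prop :=
  exists k, forall x, dom S x -> finite_class S x -> class_size_le S x k.

Definition finitely_many_infinite_classes (S : structure) : Prop :=
  exists reps : list nat, forall x, dom S x -> ~ finite_class S x ->
    exists r, In r reps /\ dom S r /\ rel S r x.

(* Main.v *)
(* Call S thin if for some k only finitely many classes have more than k
   elements; this is the right-hand side of the theorem, and it passes to every
   structure that embeds into S. Let S be thin, F an embedding of S into T, and
   k least. Then T has infinitely many classes of size at least k if k > 0, and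
   the k-th elements of classes form a decidable set that represents them. Send
   the finitely many classes of size > k to their images under F (a finite
   table), the others to distinct further classes of size at least k, and match
   elements by their rank in the class.

   If S is not thin, it is bi-embeddable with two computable structures B and C
   such that B does not embed computably into C; then S cannot be computably
   bi-embeddable with both, as B -> S -> C would be computable.
   - If S has infinitely many infinite classes, B has all classes infinite, and
     the j-th class of C is infinite iff j is outside a simple set.
   - If S has r infinite classes, so do B and C. The sizes of the finite classes
     of C are computable, those of B are not bounded by any computable function. *)

From Stdlib Require Import List Arith Lia Bool Cantor Classical ClassicalEpsilon.
Require Import Defs.
Import ListNotations.

(** * Computable functions and decidable predicates *)

(* Functions of several arguments take the list of their arguments; a bound
   variable is pushed in front of the list, as in [RPrec] and [RMin]. *)
Definition comp (n : nat) (f : list nat -> nat) : Prop :=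
  exists c, forall v, length v = n -> eval c v (f v).

Lemma comp_ext n f g :
  (forall v, length v = n -> f v = g v) -> comp n f -> comp n g.
Proof. intros E [c H]. exists c. intros v L. rewrite <- E by exact L. auto. Qed.

Fixpoint var (i : nat) (v : list nat) : nat :=
  match i with 0 => hd 0 v | S i => var i (tl v) end.

Lemma var_nth i v : var i v = nth i v 0.
Proof.
  revert v; induction i; intros [|x v]; simpl; auto.
  rewrite IHi. now destruct i.
Qed.

Lemma map_var_seq v : map (fun i => var i v) (seq 0 (length v)) = v.
Proof.
  induction v as [|x v IH]; simpl; [reflexivity|].
  rewrite <- seq_shift, map_map. simpl. now rewrite IH.
Qed.

Lemma eval_proj_var i v : i < length v -> eval (RProj i) v (var i v).
Proof. rewrite var_nth. apply ev_proj. Qed.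

Lemma comp_var i n : i < n -> comp n (var i).
Proof.
  intros L. exists (RProj i). intros v E. apply eval_proj_var. lia.
Qed.

Lemma comp_comp m n F gs :
  comp m F -> Forall (comp n) gs -> length gs = m ->
  comp n (fun v => F (map (fun g => g v) gs)).
Proof.
  intros [c Hc] Hg Hl.
  assert (exists cs, forall v, length v = n ->
    Forall2 (fun c z => eval c v z) cs (map (fun g => g v) gs)) as [cs Hcs].
  { clear Hl. induction Hg as [|g gs [d Hd] _ [cs IH]].
    - exists []. simpl. auto.
    - exists (d :: cs). intros v L. simpl. constructor; auto. }
  exists (RComp c cs). intros v L. econstructor.
  - apply Hcs, L.
  - apply Hc. now rewrite length_map.
Qed.

Lemma computable1_comp f : computable1 f <-> comp 1 (fun v => f (hd 0 v)).
Proof.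
  split; intros [c H]; exists c.
  - intros [|x [|]] L; try discriminate. apply H.
  - intros x. apply (H [x]). reflexivity.
Qed.

Lemma computable2_comp f :
  computable2 f <-> comp 2 (fun v => f (hd 0 v) (hd 0 (tl v))).
Proof.
  split; intros [c H]; exists c.
  - intros [|x [|y [|]]] L; try discriminate. apply H.
  - intros x y. apply (H [x; y]). reflexivity.
Qed.

Lemma comp_app1 f n a : computable1 f -> comp n a -> comp n (fun v => f (a v)).
Proof.
  intros Hf Ha. apply computable1_comp in Hf.
  apply (comp_comp _ n _ [a] Hf); auto.
Qed.

Lemma comp_app2 f n a b :
  computable2 f -> comp n a -> comp n b -> comp n (fun v => f (a v) (b v)).
Proof.
  intros Hf Ha Hb. apply computable2_comp in Hf.
  apply (comp_comp _ n _ [a; b] Hf); auto.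
Qed.

Lemma computable1_succ : computable1 S.
Proof. exists RSucc. intros; constructor. Qed.

Lemma comp_succ n a : comp n a -> comp n (fun v => S (a v)).
Proof. apply comp_app1, computable1_succ. Qed.

Lemma comp_const n k : comp n (fun _ => k).
Proof.
  induction k.
  - exists RZero. intros; constructor.
  - now apply comp_succ.
Qed.

Lemma comp_rec n F0 G N :
  comp n F0 ->
  comp (S (S n)) (fun w => G (hd 0 w) (hd 0 (tl w)) (tl (tl w))) ->
  comp n N ->
  comp n (fun v => nat_rect (fun _ => nat) (F0 v) (fun i r => G i r v) (N v)).
Proof.
  intros [cf Hf] [cg Hg] [cn Hn].
  (* [RPrec] recurses on its first entry, so the number of rounds is put in front of a copy of all
     the arguments. *)
  exists (RComp (RPrec cf cg) (cn :: map RProj (seq 0 n))). intros v L.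
  apply ev_comp with (zs := N v :: v).
  - constructor; [auto|]. subst n.
    enough (forall l, (forall i, In i l -> i < length v) ->
      Forall2 (fun g z => eval g v z) (map RProj l) (map (fun i => var i v) l)) as A.
    { specialize (A (seq 0 (length v))). rewrite map_var_seq in A.
      apply A. intros i Hi. apply in_seq in Hi. lia. }
    intros l A. induction l; simpl in *; constructor; auto using eval_proj_var.
  - induction (N v) as [|k IH]; simpl.
    + constructor. auto.
    + econstructor; [exact IH|].
      apply (Hg (k :: _ :: v)). simpl; lia.
Qed.

(** Recursion on the second argument with the first as parameter: the form in which the arithmetic
    operations are obtained below. *)
Lemma computable2_rec F0 G :
  computable1 F0 ->
  comp 3 (fun w => G (hd 0 w) (hd 0 (tl w)) (hd 0 (tl (tl w)))) ->
  computable2 (fun x y => nat_rect (fun _ => nat) (F0 x) (fun i r => G i r x) y).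
Proof.
  intros H0 HG. apply computable2_comp.
  apply (comp_rec 2 (fun v => F0 (hd 0 v)) (fun i r v => G i r (hd 0 v))
           (fun v => hd 0 (tl v))).
  - apply comp_app1; [exact H0|]. apply (comp_var 0); lia.
  - apply (comp_comp 3 4 _ [var 0; var 1; var 2] HG); [|reflexivity].
    repeat constructor; apply comp_var; lia.
  - apply (comp_var 1); lia.
Qed.

Lemma computable2_ext f g :
  (forall x y, f x y = g x y) -> computable2 f -> computable2 g.
Proof. intros E [c H]. exists c. intros. rewrite <- E. auto. Qed.

Lemma computable1_id : computable1 (fun x => x).
Proof. apply computable1_comp, (comp_var 0); lia. Qed.

Lemma computable1_const k : computable1 (fun _ => k).
Proof. apply computable1_comp, comp_const. Qed.

Lemma computable2_add : computable2 Nat.add.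
Proof.
  apply computable2_ext with (2 := computable2_rec _ (fun _ r _ => S r)
    computable1_id (comp_succ _ _ (comp_var 1 3 ltac:(lia)))).
  intros x y. induction y; simpl in *; lia.
Qed.

Lemma computable2_mul : computable2 Nat.mul.
Proof.
  apply computable2_ext with (2 := computable2_rec _ (fun _ r x => r + x)
    (computable1_const 0) (comp_app2 _ _ _ _ computable2_add
      (comp_var 1 3 ltac:(lia)) (comp_var 2 3 ltac:(lia)))).
  intros x y. induction y; simpl in *; lia.
Qed.

Lemma computable1_pred : computable1 Nat.pred.
Proof.
  apply computable1_comp.
  (* A recursion whose step returns the round number ends in the predecessor. *)
  apply comp_ext with (2 := comp_rec 1 (fun _ => 0) (fun i _ _ => i) _
    (comp_const _ _) (comp_var 0 3 ltac:(lia)) (comp_var 0 1 ltac:(lia))).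
  intros [|[] v] _; reflexivity.
Qed.

Lemma computable2_sub : computable2 Nat.sub.
Proof.
  apply computable2_ext with (2 := computable2_rec _ (fun _ r x => Nat.pred r)
    computable1_id (comp_app1 _ _ _ computable1_pred
      (comp_var 1 3 ltac:(lia)))).
  intros x y. induction y; simpl in *; lia.
Qed.

Lemma computable2_pow : computable2 Nat.pow.
Proof.
  apply computable2_ext with (2 := computable2_rec _ (fun _ r x => x * r)
    (computable1_const 1) (comp_app2 _ _ _ _ computable2_mul
      (comp_var 2 3 ltac:(lia)) (comp_var 1 3 ltac:(lia)))).
  intros x y. induction y; simpl in *; congruence.
Qed.

(** * Decidable predicates, bounded quantifiers and search *)

Definition decp (n : nat) (P : list nat -> Prop) : Prop :=
  exists b : list nat -> bool,
    comp n (fun v => Nat.b2n (b v)) /\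
    forall v, length v = n -> (b v = true <-> P v).

Lemma decp_ext n P Q :
  (forall v, length v = n -> (P v <-> Q v)) -> decp n P -> decp n Q.
Proof.
  intros E [b [Hc Hb]]. exists b. split; [exact Hc|].
  intros v L. rewrite <- E by exact L. auto.
Qed.

Lemma decp_not n P : decp n P -> decp n (fun v => ~ P v).
Proof.
  intros [b [Hc Hb]]. exists (fun v => negb (b v)). split.
  - apply comp_ext with (2 := comp_app2 _ _ _ _ computable2_sub
      (comp_const n 1) Hc).
    intros v _. now destruct (b v).
  - intros v L. rewrite <- Hb by exact L. destruct (b v); simpl; split;
      congruence.
Qed.

Lemma decp_and n P Q : decp n P -> decp n Q -> decp n (fun v => P v /\ Q v).
Proof.
  intros [b [Hc Hb]] [b' [Hc' Hb']]. exists (fun v => b v && b' v). split.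
  - apply comp_ext with (2 := comp_app2 _ _ _ _ computable2_mul Hc Hc').
    intros v _. now destruct (b v), (b' v).
  - intros v L. rewrite <- Hb, <- Hb' by exact L. apply andb_true_iff.
Qed.

Lemma decp_or n P Q : decp n P -> decp n Q -> decp n (fun v => P v \/ Q v).
Proof.
  intros HP HQ.
  apply decp_ext with (2 := decp_not _ _
    (decp_and _ _ _ (decp_not _ _ HP) (decp_not _ _ HQ))).
  intros v _. tauto.
Qed.

Lemma decp_imp n P Q : decp n P -> decp n Q -> decp n (fun v => P v -> Q v).
Proof.
  intros HP HQ. apply decp_ext with (2 := decp_or _ _ _ (decp_not _ _ HP) HQ).
  intros v _. tauto.
Qed.

Lemma decp_lt n a b : comp n a -> comp n b -> decp n (fun v => a v < b v).
Proof.
  intros Ha Hb. exists (fun v => a v <? b v). split.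
  (* With truncated subtraction, [1 - (1 - (b - a))] is the characteristic function of [a < b]. *)
  - apply comp_ext with (2 := comp_app2 _ _ _ _ computable2_sub
      (comp_const n 1) (comp_app2 _ _ _ _ computable2_sub
      (comp_const n 1) (comp_app2 _ _ _ _ computable2_sub Hb Ha))).
    intros v _. destruct (Nat.ltb_spec (a v) (b v)); simpl Nat.b2n; lia.
  - intros v _. apply Nat.ltb_lt.
Qed.

Lemma decp_le n a b : comp n a -> comp n b -> decp n (fun v => a v <= b v).
Proof.
  intros Ha Hb.
  apply decp_ext with (2 := decp_lt _ _ _ Ha (comp_succ _ _ Hb)). intros; lia.
Qed.

Lemma decp_eq n a b : comp n a -> comp n b -> decp n (fun v => a v = b v).
Proof.
  intros Ha Hb.
  apply decp_ext with (2 := decp_and _ _ _ (decp_le _ _ _ Ha Hb)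
    (decp_le _ _ _ Hb Ha)).
  intros v _. lia.
Qed.

Definition decrel2 (R : nat -> nat -> Prop) : Prop :=
  decp 2 (fun w => R (hd 0 w) (hd 0 (tl w))).

Lemma decp_comp m n P gs :
  decp m P -> Forall (comp n) gs -> length gs = m ->
  decp n (fun v => P (map (fun g => g v) gs)).
Proof.
  intros [b [Hc Hb]] Hg L.
  exists (fun v => b (map (fun g => g v) gs)). split.
  - apply (comp_comp m n _ gs Hc Hg L).
  - intros v _. apply Hb. now rewrite length_map.
Qed.

Lemma decp_app2 R n a b :
  decrel2 R -> comp n a -> comp n b -> decp n (fun v => R (a v) (b v)).
Proof. intros H Ha Hb. apply (decp_comp _ n _ [a; b] H); auto. Qed.

Fixpoint count (P : nat -> bool) (n : nat) : nat :=
  match n with 0 => 0 | S n => Nat.b2n (P n) + count P n end.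

Lemma comp_count n P N :
  decp (S n) (fun w => P (hd 0 w) (tl w) = true) -> comp n N ->
  comp n (fun v => count (fun i => P i v) (N v)).
Proof.
  intros [b [Hc Hb]] HN.
  assert (comp (S (S n)) (fun w => Nat.b2n (b (hd 0 w :: tl (tl w))) + hd 0 (tl w))) as A.
  { apply comp_app2; [apply computable2_add| |apply (comp_var 1); lia].
    apply comp_ext with (2 := comp_comp (S n) (S (S n)) _
      (var 0 :: map (fun i => var (2 + i)) (seq 0 n)) Hc
      ltac:(constructor; [apply comp_var; lia|]; apply Forall_map, Forall_forall;
            intros i Hi; apply in_seq in Hi; apply comp_var; lia)
      ltac:(simpl; now rewrite length_map, length_seq)).
    intros [|x [|y v]] L; try discriminate. simpl. do 3 f_equal.
    rewrite map_map. simpl in L. assert (n = length v) as -> by lia.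
    apply map_var_seq. }
  apply comp_ext with (2 := comp_rec n (fun _ => 0)
    (fun i r v => Nat.b2n (b (i :: v)) + r) N (comp_const _ _) A HN).
  intros v L. induction (N v) as [|k IH]; simpl; [reflexivity|].
  rewrite IH. do 2 f_equal. specialize (Hb (k :: v)). simpl in Hb.
  specialize (Hb ltac:(lia)).
  destruct (b (k :: v)), (P k v); intuition congruence.
Qed.

Lemma count_pos P n : 0 < count P n <-> exists i, i < n /\ P i = true.
Proof.
  induction n; simpl.
  - split; [lia|]. intros [i [H _]]; lia.
  - destruct (P n) eqn:E; simpl.
    + split; [|lia]. intros _. exists n. auto.
    + rewrite IHn. split; intros [i [H1 H2]]; exists i; split; auto.
      assert (i <> n) by congruence. lia.
Qed.

(** The number of witnesses below the bound is computable, and a witness exists iff that number is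
    positive. *)
Lemma decp_ex n N P :
  comp n N -> decp (S n) (fun w => P (hd 0 w) (tl w)) ->
  decp n (fun v => exists i, i < N v /\ P i v).
Proof.
  intros HN [b [Hc Hb]].
  assert (comp n (fun v => count (fun i => b (i :: v)) (N v))) as A.
  { apply comp_count; [|exact HN]. exists b. split; [exact Hc|].
    intros [|x v]; [discriminate|]. reflexivity. }
  apply decp_ext with (2 := decp_lt _ _ _ (comp_const _ 0) A).
  intros v L. rewrite count_pos.
  split; intros [i [H1 H2]]; exists i; split; auto;
    apply (Hb (i :: v)); simpl; auto.
Qed.

Lemma decp_all n N P :
  comp n N -> decp (S n) (fun w => P (hd 0 w) (tl w)) ->
  decp n (fun v => forall i, i < N v -> P i v).
Proof.
  intros HN HP.
  apply decp_ext with (2 := decp_not _ _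
    (decp_ex n N (fun i v => ~ P i v) HN (decp_not _ _ HP))).
  intros v _. split; [|firstorder].
  intros H i Hi. apply NNPP. intros C. apply H. eauto.
Qed.

Lemma least_number (P : nat -> Prop) :
  (exists n, P n) -> exists n, P n /\ forall i, i < n -> ~ P i.
Proof.
  intros [n Hn]. apply NNPP. intros C. revert Hn.
  induction n as [n IH] using lt_wf_ind. intros Hn. apply C. eauto.
Qed.

(** [RMin] looks for a zero, so it is run on the characteristic function of the negation of [P],
    which vanishes exactly where [P] holds. *)
Lemma comp_mu n P :
  decp (S n) (fun w => P (hd 0 w) (tl w)) ->
  (forall v, length v = n -> exists y, P y v) ->
  exists f, comp n f /\ forall v, length v = n -> P (f v) v /\ forall i, i < f v -> ~ P i v.
Proof.
  intros HP Hex. destruct (decp_not _ _ HP) as [b [[c Hc] Hb]].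
  assert (forall v, exists y, length v = n -> P y v /\ forall i, i < y -> ~ P i v) as H.
  { intros v. destruct (classic (length v = n)) as [L|L].
    - destruct (least_number _ (Hex v L)) as [y Hy]. exists y. auto.
    - exists 0. intros; contradiction. }
  (* The values are picked by choice, but leastness forces them to be those that [RMin c] finds. *)
  exists (fun v => proj1_sig (constructive_indefinite_description _ (H v))).
  split.
  - exists (RMin c). intros v L.
    destruct (constructive_indefinite_description _ (H v)) as [y Hy]; simpl.
    destruct (Hy L) as [H1 H2].
    assert (forall i, eval c (i :: v) (Nat.b2n (b (i :: v)))) as E
      by (intros; apply Hc; simpl; lia).
    assert (forall i, b (i :: v) = true <-> ~ P i v) as Hb'
      by (intros; apply (Hb (i :: v)); simpl; lia).
    constructor.
    + specialize (E y). specialize (Hb' y). destruct (b (y :: v)); [tauto|exact E].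
    + intros m Hm. exists 0. specialize (E m).
      now rewrite (proj2 (Hb' m) (H2 m Hm)) in E.
  - intros v. destruct (constructive_indefinite_description _ (H v)) as [y Hy].
    exact Hy.
Qed.

Lemma comp_graph n f P :
  decp (S n) (fun w => P (hd 0 w) (tl w)) ->
  (forall v y, length v = n -> (P y v <-> y = f v)) -> comp n f.
Proof.
  intros HP Hf. destruct (comp_mu n P HP) as [g [Hg Hs]].
  - intros v L. exists (f v). now apply Hf.
  - apply comp_ext with (2 := Hg). intros v L. apply Hf, Hs; exact L.
Qed.

(** * Pairing, and automated proofs of decidability *)

Definition cpair (x y : nat) : nat := Cantor.to_nat (x, y).
Definition left (n : nat) : nat := fst (Cantor.of_nat n).
Definition right (n : nat) : nat := snd (Cantor.of_nat n).

Lemma left_cpair x y : left (cpair x y) = x.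
Proof. unfold left, cpair. now rewrite Cantor.cancel_of_to. Qed.

Lemma right_cpair x y : right (cpair x y) = y.
Proof. unfold right, cpair. now rewrite Cantor.cancel_of_to. Qed.

Lemma cpair_left_right n : cpair (left n) (right n) = n.
Proof.
  unfold left, right, cpair. rewrite <- surjective_pairing.
  apply Cantor.cancel_to_of.
Qed.

Lemma cpair_inj x y x' y' : cpair x y = cpair x' y' -> x = x' /\ y = y'.
Proof.
  intros E. split.
  - apply (f_equal left) in E. now rewrite !left_cpair in E.
  - apply (f_equal right) in E. now rewrite !right_cpair in E.
Qed.

Lemma cpair_ge x y : x <= cpair x y /\ y <= cpair x y.
Proof. pose proof (Cantor.to_nat_non_decreasing x y). unfold cpair. lia. Qed.

Lemma computable2_cpair : computable2 cpair.
Proof.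
  apply computable2_comp.
  (* The equation for the pairing function is doubled, which avoids halving in the triangular
     number. *)
  apply comp_graph with
    (P := fun z v => z * 2 = hd 0 (tl v) * 2
      + (hd 0 (tl v) + hd 0 v) * S (hd 0 (tl v) + hd 0 v)).
  - apply decp_eq.
    + apply comp_app2; [apply computable2_mul|apply (comp_var 0); lia|apply comp_const].
    + repeat first [apply (comp_app2 Nat.add); [apply computable2_add| |]
      | apply (comp_app2 Nat.mul); [apply computable2_mul| |] | apply comp_succ
      | apply comp_const | apply (comp_var 1); lia | apply (comp_var 2); lia].
  - intros v y _. pose proof (Cantor.to_nat_spec (hd 0 v) (hd 0 (tl v))).
    unfold cpair. lia.
Qed.

(* Otherwise unification takes [cpair] for a sum. *)
Opaque cpair left right.

(** A hook of [dec], redefined whenever a new computable function or decidable predicate becomes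
    available. *)
Ltac dec_atom := fail.
Ltac dec_var i :=
  lazymatch goal with
  | |- comp _ (fun v => hd 0 (@?a v)) =>
      first [ apply (comp_var i); lia | dec_var (S i) ]
  end.
Ltac dec_step :=
  cbv beta;
  first [ apply comp_const
        | apply (comp_var 0); lia | dec_var 1
        | apply comp_succ
        | apply (comp_app2 Nat.add _ _ _ computable2_add)
        | apply (comp_app2 Nat.mul _ _ _ computable2_mul)
        | apply (comp_app2 Nat.pow _ _ _ computable2_pow)
        | apply (comp_app2 cpair _ _ _ computable2_cpair)
        | dec_atom
        | apply decp_not | apply decp_eq | apply decp_lt | apply decp_le
        | apply decp_ex | apply decp_all
        | apply decp_and | apply decp_or | apply decp_imp ].
Ltac dec := repeat dec_step.

(** The other component is at most the pair itself, so a bounded search decides the graph. *)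
Lemma computable1_left : computable1 left.
Proof.
  apply computable1_comp, comp_graph with
    (P := fun z v => exists b, b < S (hd 0 v) /\ hd 0 v = cpair z b).
  - dec.
  - intros v y _. split.
    + intros [b [_ ->]]. now rewrite left_cpair.
    + intros ->. exists (right (hd 0 v)). rewrite cpair_left_right.
      pose proof (cpair_ge (left (hd 0 v)) (right (hd 0 v))).
      rewrite cpair_left_right in *. lia.
Qed.

Lemma computable1_right : computable1 right.
Proof.
  apply computable1_comp, comp_graph with
    (P := fun z v => exists b, b < S (hd 0 v) /\ hd 0 v = cpair b z).
  - dec.
  - intros v y _. split.
    + intros [b [_ ->]]. now rewrite right_cpair.
    + intros ->. exists (left (hd 0 v)). rewrite cpair_left_right.
      pose proof (cpair_ge (left (hd 0 v)) (right (hd 0 v))).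
      rewrite cpair_left_right in *. lia.
Qed.

Ltac dec_atom ::=
  first [ apply (comp_app1 left _ _ computable1_left)
        | apply (comp_app1 right _ _ computable1_right) ].

(** * A universal predicate *)

(* [D] is read as the finite set of positions of its binary digits 1. *)
Definition mem (D q : nat) : Prop := Nat.testbit D q = true.

(** Bounded quantifiers and arithmetic only, the form that [dec] handles: [a] collects the digits
    above position [q], and [b] those below. *)
Lemma mem_iff D q :
  mem D q <-> exists a, a < S D /\ exists b, b < S D /\
    D = (a * 2 + 1) * 2 ^ q + b /\ b < 2 ^ q.
Proof.
  unfold mem. rewrite Nat.testbit_true.
  assert (2 ^ q <> 0) as Hq by (apply Nat.pow_nonzero; lia). split.
  - intros H. exists (D / 2 ^ q / 2).
    pose proof (Nat.div_mod_eq D (2 ^ q)). pose proof (Nat.div_mod_eq (D / 2 ^ q) 2).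
    pose proof (Nat.mod_upper_bound D (2 ^ q) Hq).
    assert (D / 2 ^ q <= D) by nia.
    split; [lia|]. exists (D mod 2 ^ q).
    rewrite H in *. split; [nia|]. split; [|assumption]. nia.
  - intros [a [_ [b [_ [-> Hb]]]]].
    rewrite Nat.div_add_l, (Nat.div_small b), Nat.add_0_r by assumption.
    rewrite Nat.add_comm, Nat.Div0.mod_add. reflexivity.
Qed.

Lemma decrel2_mem : decrel2 mem.
Proof.
  eapply decp_ext; [intros v _; symmetry; apply mem_iff|]. dec.
Qed.

Lemma mem_lt D q : mem D q -> q < D.
Proof.
  rewrite mem_iff. intros [a [_ [b [_ [-> _]]]]].
  pose proof (Nat.pow_gt_lin_r 2 q). nia.
Qed.

Lemma mem_of_list l : exists D, forall q, mem D q <-> In q l.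
Proof.
  induction l as [|x l [D IH]].
  - exists 0. intros q. unfold mem. rewrite Nat.bits_0. simpl. intuition congruence.
  - exists (Nat.lor D (2 ^ x)). intros q. simpl. rewrite <- IH. unfold mem.
    rewrite Nat.lor_spec, orb_true_iff, Nat.pow2_bits_eqb, Nat.eqb_eq. tauto.
Qed.

(** The number of the claim that the code [c] sends the input [v] to [y]. *)
Definition ent (c v y : nat) : nat := cpair c (cpair v y).
Definition ncons (x l : nat) : nat := S (cpair x l).

Fixpoint enc_list (v : list nat) : nat :=
  match v with [] => 0 | x :: v => ncons x (enc_list v) end.

(** The inner fixpoint is [encs] below, inlined because the recursion is nested. *)
Fixpoint enc (c : rec_code) : nat :=
  match c with
  | RZero => cpair 0 0
  | RSucc => cpair 1 0
  | RProj i => cpair 2 i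
  | RComp f gs =>
      cpair 3 (cpair (enc f)
        ((fix encs gs := match gs with
                         | [] => cpair 6 0
                         | g :: gs => cpair 7 (cpair (enc g) (encs gs))
                         end) gs))
  | RPrec f g => cpair 4 (cpair (enc f) (enc g))
  | RMin f => cpair 5 (enc f)
  end.

Fixpoint encs (gs : list rec_code) : nat :=
  match gs with
  | [] => cpair 6 0
  | g :: gs => cpair 7 (cpair (enc g) (encs gs))
  end.

Lemma enc_comp f gs : enc (RComp f gs) = cpair 3 (cpair (enc f) (encs gs)).
Proof. reflexivity. Qed.

(* [just M c v y]: the claim "the code [c] sends the input [v] to [y]" follows
   by one evaluation rule from claims in [M]. Codes with tags 6 and 7 are
   lists of codes, evaluated componentwise. *)
Inductive just (M : nat -> Prop) : nat -> nat -> nat -> Prop :=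
| just_zero v : just M (cpair 0 0) v 0
| just_succ x v : just M (cpair 1 0) (ncons x v) (S x)
| just_proj0 x v : just M (cpair 2 0) (ncons x v) x
| just_projS i x v y :
    M (ent (cpair 2 i) v y) -> just M (cpair 2 (S i)) (ncons x v) y
| just_comp f gs v zs y :
    M (ent gs v zs) -> M (ent f zs y) -> just M (cpair 3 (cpair f gs)) v y
| just_nil v : just M (cpair 6 0) v 0
| just_cons g gs v z zs :
    M (ent g v z) -> M (ent gs v zs) ->
    just M (cpair 7 (cpair g gs)) v (ncons z zs)
| just_prec0 f g v y :
    M (ent f v y) -> just M (cpair 4 (cpair f g)) (ncons 0 v) y
| just_precS f g n v r y :
    M (ent (cpair 4 (cpair f g)) (ncons n v) r) ->
    M (ent g (ncons n (ncons r v)) y) ->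
    just M (cpair 4 (cpair f g)) (ncons (S n) v) y
| just_min f v n :
    M (ent f (ncons n v) 0) ->
    (forall m, m < n -> exists k, M (ent f (ncons m v) (S k))) ->
    just M (cpair 5 f) v n.

(** A finite closed set of claims serves as a derivation with the order of its steps forgotten. *)
Definition closed (M : nat -> Prop) : Prop :=
  forall c v y, M (ent c v y) -> just M c v y.

Lemma just_mono (M M' : nat -> Prop) c v y :
  (forall q, M q -> M' q) -> just M c v y -> just M' c v y.
Proof.
  intros H J. destruct J; econstructor; eauto.
  intros m L. destruct (H1 m L). eauto.
Qed.

Definition certified (c v y : nat) : Prop :=
  exists l, closed (fun q => In q l) /\ In (ent c v y) l.

Lemma ent_inj c v y c' v' y' :
  ent c v y = ent c' v' y' -> c = c' /\ v = v' /\ y = y'.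
Proof.
  intros E. apply cpair_inj in E as [-> E]. apply cpair_inj in E as [-> ->]. auto.
Qed.

Lemma certified_add l c v y :
  closed (fun q => In q l) -> just (fun q => In q l) c v y -> certified c v y.
Proof.
  intros Hl J. exists (ent c v y :: l). split; [|now left].
  intros c' v' y' [E|H].
  - apply ent_inj in E as [-> [-> ->]]. eapply just_mono; [|exact J]. now right.
  - eapply just_mono; [|apply Hl, H]. now right.
Qed.

Lemma closed_app l l' :
  closed (fun q => In q l) -> closed (fun q => In q l') ->
  closed (fun q => In q (l ++ l')).
Proof.
  intros H H' c v y Hin. apply in_app_or in Hin as [A|A].
  - eapply just_mono; [|apply H, A]. intros; apply in_or_app; auto.
  - eapply just_mono; [|apply H', A]. intros; apply in_or_app; auto.
Qed.

Lemma closed_nil : closed (fun q => In q []).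
Proof. intros c v y []. Qed.

(** Induction that also supplies hypotheses for the evaluations nested inside [Forall2]. *)
Lemma eval_nested_ind (P : rec_code -> list nat -> nat -> Prop) :
  (forall v, P RZero v 0) ->
  (forall x v, P RSucc (x :: v) (S x)) ->
  (forall i v, i < length v -> P (RProj i) v (nth i v 0)) ->
  (forall f gs v zs y,
    Forall2 (fun g z => P g v z) gs zs -> P f zs y -> P (RComp f gs) v y) ->
  (forall f g v y, P f v y -> P (RPrec f g) (0 :: v) y) ->
  (forall f g n v r y, P (RPrec f g) (n :: v) r -> P g (n :: r :: v) y ->
    P (RPrec f g) (S n :: v) y) ->
  (forall f v n, P f (n :: v) 0 ->
    (forall m, m < n -> exists k, P f (m :: v) (S k)) -> P (RMin f) v n) ->
  forall c v y, eval c v y -> P c v y.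
Proof.
  intros Hzero Hsucc Hproj Hcomp Hprec0 HprecS Hmin.
  fix IH 4. intros c v y H.
  destruct H as [| | i v L|f gs v zs y Hgs Hf| | |f v n H0 Hm];
    [auto|auto|auto| |eauto|eauto|].
  - apply Hcomp with zs; [|auto]. clear -IH Hgs. induction Hgs; constructor; auto.
  - apply Hmin; [auto|]. intros m L. destruct (Hm m L) as [k Hk].
    exists k. auto.
Qed.

(** Completeness of certificates: those of the subevaluations are united and the new claim is added
    on top. *)
Lemma certified_eval c v y : eval c v y -> certified (enc c) (enc_list v) y.
Proof.
  intros H. induction H as [v|x v|i v L|f gs v zs y Hgs [l [Cl Il]]|f g v y [l [Cl Il]]
    |f g n v r y [l [Cl Il]] [l' [Cl' Il']]|f v n [l [Cl Il]] Hm]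
    using eval_nested_ind.
  - eapply certified_add; [apply closed_nil|constructor].
  - eapply certified_add; [apply closed_nil|constructor].
  - revert i L. induction v as [|x v IH]; simpl; intros i L; [lia|].
    destruct i as [|i].
    + eapply certified_add; [apply closed_nil|constructor].
    + destruct (IH i ltac:(lia)) as [l [Cl Il]].
      apply certified_add with l; [exact Cl|]. constructor. exact Il.
  - rewrite enc_comp.
    assert (certified (encs gs) (enc_list v) (enc_list zs)) as [l' [Cl' Il']].
    { clear -Hgs. induction Hgs as [|g z gs zs [l [Cl Il]] _ [l' [Cl' Il']]]; simpl.
      - eapply certified_add; [apply closed_nil|constructor].
      - apply certified_add with (l ++ l'); [now apply closed_app|].
        constructor; apply in_or_app; auto. }
    apply certified_add with (l ++ l'); [now apply closed_app|].
    econstructor; apply in_or_app; eauto.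
  - apply certified_add with l; [exact Cl|]. constructor. exact Il.
  - apply certified_add with (l ++ l'); [now apply closed_app|].
    eapply just_precS; apply in_or_app; eauto.
  (* The certificates of the [n] failed trials of the minimization are united into one list. *)
  - assert (exists l', closed (fun q => In q l') /\ forall m, m < n ->
      exists k, In (ent (enc f) (enc_list (m :: v)) (S k)) l') as [l' [Cl' Il']].
    { clear -Hm. induction n as [|n IH].
      - exists []. split; [apply closed_nil|]. intros; lia.
      - destruct IH as [l [Cl Il]]; [auto|].
        destruct (Hm n) as [k [l' [Cl' Il']]]; [lia|].
        exists (l ++ l'). split; [now apply closed_app|].
        intros m L. destruct (Nat.eq_dec m n) as [->|N].
        + exists k. apply in_or_app; auto.
        + destruct (Il m) as [j Hj]; [lia|]. exists j. apply in_or_app; auto. }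
    apply certified_add with (l ++ l'); [now apply closed_app|].
    apply just_min; [apply in_or_app; auto|].
    intros m L. destruct (Il' m L) as [k Hk]. exists k. apply in_or_app; auto.
Qed.

Ltac inv_just H :=
  match type of H with
  | just _ ?c ?v ?y =>
      remember c as c0 eqn:Ec; remember v as v0 eqn:Ev; remember y as y0 eqn:Ey;
      destruct H
  end;
  unfold ncons in *;
  repeat match goal with
  | E : S _ = S _ |- _ => apply Nat.succ_inj in E
  | E : cpair _ _ = cpair _ _ |- _ => apply cpair_inj in E as [? ?]
  | E : 0 = S _ |- _ => discriminate E
  | E : S _ = 0 |- _ => discriminate E
  end; subst.

(** Soundness of certificates. Inverting the justification of a claim yields claims about the
    subevaluations, whose values are forced by induction on the true evaluation. *)
Lemma closed_eval M c v y :
  closed M -> eval c v y -> forall y', M (ent (enc c) (enc_list v) y') -> y' = y.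
Proof.
  intros CM H. induction H as [v|x v|i v L|f gs v zs y Hgs IH|f g v y IH
    |f g n v r y IH1 IH2|f v n IH0 IHm]
    using eval_nested_ind; intros y' HM.
  - apply CM in HM. simpl in HM. inv_just HM. reflexivity.
  - apply CM in HM. simpl in HM. inv_just HM. reflexivity.
  - revert i L y' HM. induction v as [|x v IH]; simpl; intros i L y' HM; [lia|].
    apply CM in HM. inv_just HM; [reflexivity|].
    apply IH; [lia|assumption].
  - rewrite enc_comp in HM. apply CM in HM. inv_just HM.
    match goal with H : M (ent (encs gs) _ ?z) |- _ =>
      rename H into Hz; rename z into z' end.
    assert (z' = enc_list zs) as ->; [|auto].
    clear -CM Hgs Hz. revert z' Hz.
    induction Hgs as [|g z gs zs Hg _ IH]; simpl; intros z' Hz.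
    + apply CM in Hz. inv_just Hz. reflexivity.
    + apply CM in Hz. inv_just Hz.
      unfold ncons. do 2 f_equal; auto.
  - apply CM in HM. simpl in HM. inv_just HM. auto.
  - apply CM in HM. simpl in HM. inv_just HM.
    match goal with H : M (ent (cpair 4 _) _ _) |- _ => apply IH1 in H; subst end.
    auto.
  - apply CM in HM. simpl in HM. inv_just HM.
    (* A result [y'] below [n] would claim the value 0 where [f] is positive; one above [n] would
       claim a positive value at [n], where [f] is 0. *)
    destruct (lt_eq_lt_dec y' n) as [[L|E]|L]; [|exact E|].
    + destruct (IHm y' L) as [k Hk].
      match goal with H : M (ent _ _ 0) |- _ => apply Hk in H; discriminate end.
    + match goal with H : forall m, m < y' -> _ |- _ =>
        destruct (H n L) as [k Hk] end.
      apply IH0 in Hk. discriminate.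
Qed.

(** Inversion of [just] with all quantifiers bounded, which makes it decidable. The bounds hold
    because components never exceed a pair. The rules for a nonempty input share one disjunct. *)
Lemma just_mem_iff D c v y :
  c < D -> v < D -> y < D ->
  (just (mem D) c v y <->
   c = cpair 0 0 /\ y = 0
   \/ (exists w, w < D /\ exists x, x < D /\ v = ncons x w /\
        (c = cpair 1 0 /\ y = S x \/ c = cpair 2 0 /\ y = x \/
         (exists i, i < D /\ c = cpair 2 (S i) /\ mem D (ent (cpair 2 i) w y)) \/
         (exists f, f < D /\ exists g, g < D /\ c = cpair 4 (cpair f g) /\
            (x = 0 /\ mem D (ent f w y) \/
             exists n, n < D /\ x = S n /\ exists r, r < D /\
               mem D (ent c (ncons n w) r) /\
               mem D (ent g (ncons n (ncons r w)) y)))))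
   \/ (exists f, f < D /\ exists g, g < D /\ c = cpair 3 (cpair f g) /\
        exists z, z < D /\ mem D (ent g v z) /\ mem D (ent f z y))
   \/ c = cpair 6 0 /\ y = 0
   \/ (exists g, g < D /\ exists h, h < D /\ c = cpair 7 (cpair g h) /\
        exists z, z < D /\ exists w, w < D /\ y = ncons z w /\
          mem D (ent g v z) /\ mem D (ent h v w))
   \/ (exists f, f < D /\ c = cpair 5 f /\ mem D (ent f (ncons y v) 0) /\
        forall m, m < y -> exists k, k < D /\ mem D (ent f (ncons m v) (S k)))).
Proof.
  intros Lc Lv Ly.
  assert (forall c v y, mem D (ent c v y) -> v < D /\ y < D) as B.
  { intros c' v' y' H. apply mem_lt in H. unfold ent in H.
    pose proof (cpair_ge c' (cpair v' y')). pose proof (cpair_ge v' y'). lia. }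
  assert (forall a b, cpair a b < D -> a < D /\ b < D) as B2.
  { intros a b H. pose proof (cpair_ge a b). lia. }
  assert (forall a b, ncons a b < D -> a < D /\ b < D) as B3.
  { unfold ncons. intros a b H. apply B2. lia. }
  split.
  - intros J. destruct J;
      repeat match goal with
      | H : cpair _ _ < D |- _ => apply B2 in H as [? ?]
      | H : ncons _ _ < D |- _ => apply B3 in H as [? ?]
      end.
    + now left.
    + right; left. exists v; split; [auto|]. exists x; split; [auto|]. auto.
    + right; left. exists v; split; [auto|]. exists x; split; [auto|]. auto 6.
    + right; left. exists v; split; [auto|]. exists x; split; [auto|]. 
      split; [auto|]. right; right; left. exists i. split; [lia|auto].
    + right; right; left. exists f; split; [auto|]. exists gs; split; [auto|].
      split; [auto|]. exists zs. split; [eapply B; eauto|auto].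
    + auto 6.
    + do 4 right; left. exists g; split; [auto|]. exists gs; split; [auto|].
      split; [auto|]. exists z. split; [eapply B; eauto|].
      exists zs. split; [eapply B; eauto|auto].
    + right; left. exists v; split; [auto|]. exists 0; split; [auto|].
      split; [auto|]. do 3 right. exists f; split; [auto|]. exists g; split; [auto|].
      auto.
    + right; left. exists v; split; [auto|]. exists (S n); split; [auto|].
      split; [auto|]. do 3 right. exists f; split; [auto|]. exists g; split; [auto|].
      split; [auto|]. right. exists n; split; [lia|]. split; [auto|].
      exists r; split; [eapply B; eauto|auto].
    + do 5 right. exists f; split; [auto|]. split; [auto|]. split; [auto|].
      intros m L. destruct (H0 m L) as [k Hk]. exists k. split; [|auto].
      apply B in Hk. lia.
  - intros [J|[J|[J|[J|[J|J]]]]].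
    + destruct J as [-> ->]. constructor.
    + destruct J as [w [_ [x [_ [-> [J|[J|[J|J]]]]]]]].
      * destruct J as [-> ->]. constructor.
      * destruct J as [-> ->]. constructor.
      * destruct J as [i [_ [-> J]]]. now constructor.
      * destruct J as [f [_ [g [_ [-> [[-> J]|J]]]]]]; [now constructor|].
        destruct J as [n [_ [-> [r [_ [J J']]]]]]. econstructor; eauto.
    + destruct J as [f [_ [g [_ [-> [z [_ [J J']]]]]]]]. econstructor; eauto.
    + destruct J as [-> ->]. constructor.
    + destruct J as [g [_ [h [_ [-> [z [_ [w [_ [-> [J J']]]]]]]]]]].
      constructor; auto.
    + destruct J as [f [_ [-> [J J']]]]. constructor; [auto|].
      intros m L. destruct (J' m L) as [k [_ Hk]]. eauto.
Qed.

Ltac dec_atom ::=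
  first [ apply (comp_app1 left _ _ computable1_left)
        | apply (comp_app1 right _ _ computable1_right)
        | apply (decp_app2 mem _ _ _ decrel2_mem) ].

(** [D] is a certificate that the code [e] sends the one-element list of [x], encoded as
    [ncons x 0], to [y]. *)
Definition halts (e x y D : nat) : Prop :=
  closed (mem D) /\ mem D (ent e (ncons x 0) y).

Lemma dec_halts n e x y D :
  comp n e -> comp n x -> comp n y -> comp n D ->
  decp n (fun v => halts (e v) (x v) (y v) (D v)).
Proof.
  intros He Hx Hy HD.
  enough (decp 4 (fun w => halts (hd 0 w) (hd 0 (tl w)) (hd 0 (tl (tl w)))
    (hd 0 (tl (tl (tl w)))))) as A
    by (apply (decp_comp _ n _ [e; x; y; D] A); auto).
  apply decp_and; [|unfold ent, ncons; dec].
  eapply decp_ext.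
  - intros w _. symmetry. set (D' := hd 0 (tl (tl (tl w)))).
    (* Members of the set and their components lie below its number, so bounded quantifiers
       suffice. *)
    assert (closed (mem D') <-> forall c, c < D' -> forall v, v < D' ->
      forall y, y < D' -> mem D' (ent c v y) -> just (mem D') c v y) as E.
    { split; [intros H; intros; now apply H|].
      intros H c' v' y' M. pose proof (mem_lt _ _ M) as L. unfold ent in L.
      pose proof (cpair_ge c' (cpair v' y')). pose proof (cpair_ge v' y').
      apply H; auto; lia. }
    rewrite E.
    assert (forall P A B : nat -> Prop, (forall c, P c -> (A c <-> B c)) ->
      ((forall c, P c -> A c) <-> (forall c, P c -> B c))) as F by firstorder.
    apply F; intros c Lc. apply F; intros v' Lv. apply F; intros y' Ly.
    apply imp_iff_compat_l. exact (just_mem_iff D' c v' y' Lc Lv Ly).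
  - unfold ent, ncons. dec.
Qed.

(** The index is the encoded program of [h]; the two directions are soundness and completeness of
    certificates. *)
Lemma halts_computable h :
  computable1 h -> exists e, forall x y, (exists D, halts e x y D) <-> y = h x.
Proof.
  intros [c Hc]. exists (enc c). intros x y. split.
  - intros [D [C M]]. apply (closed_eval _ c [x] _ C (Hc x)). exact M.
  - intros ->. destruct (certified_eval _ _ _ (Hc x)) as [l [C I]].
    destruct (mem_of_list l) as [D HD]. exists D. split.
    + intros c' v' y' M. apply HD, C in M.
      eapply just_mono; [|exact M]. intros q. apply HD.
    + apply HD. exact I.
Qed.

(** * Decidable partial equivalence relations *)

Local Coercion is_true : bool >-> Sortclass.

Lemma comp_b2n n B : decp n (fun v => B v = true) -> comp n (fun v => Nat.b2n (B v)).
Proof.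
  intros [b [Hc Hb]]. apply comp_ext with (2 := Hc).
  intros v L. specialize (Hb v L). destruct (b v), (B v); intuition congruence.
Qed.

Lemma decrel2_bool (R : nat -> nat -> Prop) :
  decrel2 R ->
  exists X : nat -> nat -> bool, decrel2 X /\ forall x y, X x y <-> R x y.
Proof.
  intros [b [Hc Hb]].
  assert (forall x y, b [x; y] <-> R x y) as E by (intros; now apply (Hb [x; y])).
  exists (fun x y => b [x; y]). split; [|exact E].
  apply (decp_ext 2 (fun w => R (hd 0 w) (hd 0 (tl w)))).
  - intros v _. symmetry. apply E.
  - now exists b.
Qed.

(** * Ranks and finite cardinalities *)

Lemma count_ext P Q n : (forall i, P i = Q i) -> count P n = count Q n.
Proof. intros E. induction n; simpl; congruence. Qed.

Lemma count_mono P N M : N <= M -> count P N <= count P M.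
Proof. induction 1; simpl; lia. Qed.

Lemma count_S (P : nat -> bool) y : P y -> count P (S y) = S (count P y).
Proof. intros H. simpl. now rewrite H. Qed.

Lemma count_nth (P : nat -> bool) n N : n < count P N -> exists y, P y /\ count P y = n.
Proof.
  induction N as [|N IH]; simpl; [lia|]. intros H.
  destruct (le_lt_dec (count P N) n) as [L|L]; [|auto].
  exists N. destruct (P N); simpl in H; [split; [reflexivity|lia]|lia].
Qed.

Lemma count_inj (P : nat -> bool) y y' : P y -> P y' -> count P y = count P y' -> y = y'.
Proof.
  assert (forall y y', P y -> y < y' -> count P y < count P y') as A.
  { intros a b Ha L. apply count_S in Ha. apply (count_mono P) in L. lia. }
  intros H H' E. destruct (lt_eq_lt_dec y y') as [[L|L]|L]; [|exact L|].
  - apply A in L; [lia|exact H].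
  - apply A in L; [lia|exact H'].
Qed.

Lemma count_filter P N : count P N = length (filter P (seq 0 N)).
Proof.
  induction N as [|N IH]; [reflexivity|].
  rewrite seq_S, filter_app, length_app, <- IH. simpl.
  destruct (P N); simpl; lia.
Qed.

(** A lower bound on the cardinality of [P]; infinity is expressed by requiring it for all [n]. *)
Definition atleast (P : nat -> bool) (n : nat) : Prop := exists N, n <= count P N.

Lemma atleast_ext P Q n : (forall i, P i = Q i) -> atleast P n -> atleast Q n.
Proof. intros E [N H]. exists N. now rewrite <- (count_ext P Q). Qed.

Lemma atleast_le P n m : m <= n -> atleast P n -> atleast P m.
Proof. intros L [N H]. exists N. lia. Qed.

Lemma in_list_max x l : In x l -> x <= list_max l.
Proof.
  intros H. pose proof (proj1 (list_max_le l (list_max l)) (le_n _)) as A.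
  rewrite Forall_forall in A. auto.
Qed.

Lemma atleast_list (P : nat -> bool) l :
  NoDup l -> (forall x, In x l -> P x) -> atleast P (length l).
Proof.
  intros D H. exists (S (list_max l)). rewrite count_filter.
  apply NoDup_incl_length; [exact D|]. intros x Hx.
  apply filter_In. split; [|now apply H].
  apply in_seq. apply in_list_max in Hx. lia.
Qed.

Lemma atleast_inj_image (P Q : nat -> bool) F n :
  (forall x, P x -> Q (F x)) ->
  (forall x x', P x -> P x' -> F x = F x' -> x = x') ->
  atleast P n -> atleast Q n.
Proof.
  intros H I [N L]. rewrite count_filter in L.
  apply atleast_le with (1 := L). rewrite <- (length_map F).
  apply atleast_list.
  - apply NoDup_map_NoDup_ForallPairs.
    + intros x x' Hx Hx'. apply filter_In in Hx as [_ Hx].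
      apply filter_In in Hx' as [_ Hx']. now apply I.
    + apply NoDup_filter, seq_NoDup.
  - intros y Hy. apply in_map_iff in Hy as [x [<- Hx]].
    apply filter_In in Hx as [_ Hx]. now apply H.
Qed.

Lemma atleast_segment (P : nat -> bool) a n :
  (forall i, i < n -> P (a + i)) -> atleast P n.
Proof.
  intros H. rewrite <- (length_seq n a). apply atleast_list; [apply seq_NoDup|].
  intros x Hx. apply in_seq in Hx. replace x with (a + (x - a)) by lia.
  apply H. lia.
Qed.

Lemma not_atleast_bound (P : nat -> bool) n :
  ~ atleast P n -> exists N, forall i, P i -> i < N.
Proof.
  induction n as [|n IH]; intros H.
  - destruct H. exists 0. lia.
  - destruct (classic (atleast P n)) as [[N L]|A]; [|auto].
    exists N. intros i Hi. apply NNPP. intros C. apply H. exists (S i).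
    rewrite count_S by exact Hi. assert (N <= i) as L' by lia.
    apply (count_mono P) in L'. lia.
Qed.

Lemma bound_not_atleast (P : nat -> bool) N :
  (forall i, P i -> i < N) -> ~ atleast P (S N).
Proof.
  intros H [M L]. rewrite count_filter in L.
  enough (length (filter P (seq 0 M)) <= length (seq 0 N)) by (rewrite length_seq in *; lia).
  apply NoDup_incl_length; [apply NoDup_filter, seq_NoDup|].
  intros x Hx. apply filter_In in Hx as [_ Hx]. apply H in Hx. apply in_seq. lia.
Qed.

(** [u i] is the element of [G] of rank [i], found by search; its rank gives [i] back, whence
    injectivity. *)
Lemma dec_infinite_enum (G : nat -> Prop) :
  decp 1 (fun v => G (hd 0 v)) -> (forall N, exists y, N <= y /\ G y) ->
  exists u, computable1 u /\ (forall i, G (u i)) /\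
    forall i j, u i = u j -> i = j.
Proof.
  intros [b [Hc Hb]] Hinf. set (g := fun y => b [y]).
  assert (forall y, g y <-> G y) as Hg by (intros y; apply (Hb [y]); reflexivity).
  assert (decp 1 (fun v => g (hd 0 v) = true)) as dg.
  { eapply decp_ext; [|exists b; split; [exact Hc|exact Hb]].
    intros v _. symmetry. apply Hg. }
  destruct (comp_mu 1 (fun y v => g y /\ count g y = hd 0 v)) as [u [Cu Hu]].
  - assert (computable1 (fun y => Nat.b2n (g y))) as Cg
      by (apply computable1_comp; apply comp_b2n in dg; exact dg).
    apply decp_and.
    + apply decp_ext with (2 := decp_eq _ _ _
        (comp_app1 _ _ _ Cg (comp_var 0 2 ltac:(lia))) (comp_const _ 1)).
      intros v _. simpl. destruct (g (hd 0 v)); simpl; unfold is_true; split;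
        congruence.
    + apply decp_eq; [|apply (comp_var 1); lia].
      apply (comp_count 2 (fun i _ => g i)); [|apply (comp_var 0); lia].
      apply (decp_comp 1 3 _ [var 0] dg); [|reflexivity].
      constructor; [apply comp_var; lia|constructor].
  - intros v _. generalize (hd 0 v) as n. clear v. intros n.
    enough (exists N, n < count g N) as [N L] by (eapply count_nth; eassumption).
    induction n as [|n [N L]].
    + destruct (Hinf 0) as [y [_ Hy]]. exists (S y). apply Hg, count_S in Hy. lia.
    + destruct (Hinf N) as [y [Ly Hy]]. exists (S y).
      apply Hg, count_S in Hy. apply (count_mono g) in Ly. lia.
  - exists (fun i => u [i]). split; [|split].
    + apply computable1_comp, comp_ext with (2 := Cu).
      intros [|x [|]] L; try discriminate. reflexivity.
    + intros i. apply Hg, (Hu [i] eq_refl).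
    + intros i j E. destruct (Hu [i] eq_refl) as [[_ Hi] _].
      destruct (Hu [j] eq_refl) as [[_ Hj] _]. simpl in *. congruence.
Qed.

(** One relation codes a whole structure: the domain is the set of [x] with [X x x]. *)
Definition per (X : nat -> nat -> bool) : Prop :=
  (forall x y, X x y -> X y x) /\ (forall x y z, X x y -> X y z -> X x z).

Lemma per_row X x y : per X -> X x y -> forall i, X x i = X y i.
Proof.
  intros [Hs Ht] H i. apply eq_true_iff_eq. split; intros A.
  - apply (Ht y x i); auto.
  - apply (Ht x y i); auto.
Qed.

Lemma per_refl_l X x y : per X -> X x y -> X x x.
Proof. intros [Hs Ht] H. eauto. Qed.

Lemma per_refl_r X x y : per X -> X x y -> X y y.
Proof. intros [Hs Ht] H. eauto. Qed.

(** * Embeddings built class by class *)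

Definition pemb (X Y : nat -> nat -> bool) (F : nat -> nat) : Prop :=
  (forall x, X x x -> Y (F x) (F x)) /\
  (forall x x', X x x -> X x' x' -> F x = F x' -> x = x') /\
  (forall x x', X x x -> X x' x' -> (X x x' <-> Y (F x) (F x'))).

Lemma pemb_atleast X Y F x n :
  per X -> pemb X Y F -> X x x -> atleast (X x) n -> atleast (Y (F x)) n.
Proof.
  intros HX [H1 [H2 H3]] Hx. apply (atleast_inj_image _ _ F).
  - intros y Hy. apply H3; auto. eapply per_refl_r; eauto.
  - intros y y' Hy Hy'. apply H2; eapply per_refl_r; eauto.
Qed.

Fixpoint table (X : nat -> nat -> bool) (L : list (nat * nat)) (x d : nat) : nat :=
  match L with
  | [] => d
  | (a, b) :: L => if X a x then b else table X L x d
  end.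

Lemma table_spec (X : nat -> nat -> bool) (L : list (nat * nat)) x d :
  (exists a b, In (a, b) L /\ X a x /\ table X L x d = b) \/
  (forall a b, In (a, b) L -> ~ X a x) /\ table X L x d = d.
Proof.
  induction L as [|[a b] L IH]; simpl.
  - right. split; [auto|reflexivity].
  - destruct (X a x) eqn:E.
    + left. exists a, b. auto.
    + destruct IH as [[a' [b' [H1 H2]]]|[H1 H2]].
      * left. exists a', b'. auto.
      * right. split; [|exact H2]. intros a' b' [H|H]; [|eauto].
        injection H as -> ->. unfold is_true. congruence.
Qed.

Lemma comp_table n (X : nat -> nat -> bool) (L : list (nat * nat)) x d :
  decrel2 X -> comp n x -> comp n d -> comp n (fun v => table X L (x v) (d v)).
Proof.
  intros dX Hx Hd. induction L as [|[a b] L IH]; simpl; [exact Hd|].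
  assert (comp n (fun v => Nat.b2n (X a (x v)))) as A.
  { apply comp_b2n. apply (decp_app2 _ _ _ _ dX); [apply comp_const|exact Hx]. }
  (* Definition by cases, written as a sum of products with the test and its complement. *)
  apply comp_ext with (2 := comp_app2 _ _ _ _ computable2_add
    (comp_app2 _ _ _ _ computable2_mul A (comp_const n b))
    (comp_app2 _ _ _ _ computable2_mul
      (comp_app2 _ _ _ _ computable2_sub (comp_const n 1) A) IH)).
  intros v _. destruct (X a (x v)); simpl; lia.
Qed.

(* The element of rank [k] in the class of [x] goes to the element of rank [k]
   in the class of [table X L x (u m)], where [m] is the least element of the
   class of [x]. *)
Lemma embedding_of_classes X Y L u :
  per X -> per Y -> decrel2 X -> decrel2 Y ->
  (forall a b, In (a, b) L ->
    Y b b /\ forall n, atleast (X a) n -> atleast (Y b) n) ->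
  (forall a b a' b', In (a, b) L -> In (a', b') L -> (X a a' <-> Y b b')) ->
  (forall x, X x x -> (forall a b, In (a, b) L -> ~ X a x) ->
    Y (u x) (u x) /\ (forall a b, In (a, b) L -> ~ Y b (u x)) /\
    forall n, atleast (X x) n -> atleast (Y (u x)) n) ->
  (forall x x', X x x -> X x' x' -> (forall a b, In (a, b) L -> ~ X a x) ->
    (forall a b, In (a, b) L -> ~ X a x') -> Y (u x) (u x') -> x = x') ->
  exists F, pemb X Y F /\ (computable1 u -> computable1 F).
Proof.
  intros HX HY dX dY HL HLL Hu Huu.
  pose proof HX as [sX tX]. pose proof HY as [sY tY].
  (* [u] need not respect classes, so it is only evaluated at the least element of each. *)
  assert (exists m, computable1 m /\ (forall x, X x x -> X x (m x)) /\
    forall x x', X x x' -> m x = m x') as [m [Cm [Hm Hmm]]].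
  { destruct (comp_mu 1 (fun y v => X (hd 0 v) (hd 0 v) -> X (hd 0 v) y))
      as [m [Cm Hm]].
    - apply decp_imp; apply (decp_app2 _ _ _ _ dX);
        first [apply (comp_var 0); lia|apply (comp_var 1); lia].
    - intros v _. exists (hd 0 v). auto.
    - exists (fun x => m [x]). split; [|split].
      + apply computable1_comp, comp_ext with (2 := Cm).
        intros [|x [|]] E; try discriminate. reflexivity.
      + intros x. apply (Hm [x] eq_refl).
      + intros x x' H. destruct (Hm [x] eq_refl) as [H1 H2].
        destruct (Hm [x'] eq_refl) as [H1' H2']. simpl in *.
        pose proof (per_refl_l _ _ _ HX H) as Hx.
        pose proof (per_refl_r _ _ _ HX H) as Hx'.
        destruct (lt_eq_lt_dec (m [x]) (m [x'])) as [[A|A]|A]; [|exact A|].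
        * apply H2' in A. destruct A. eauto.
        * apply H2 in A. destruct A. eauto. }
  (* [g x] names the target class of [x] and depends only on the class of [x]. *)
  set (g := fun x => table X L x (u (m x))).
  assert (forall a x, X x x -> ~ X a x -> ~ X a (m x)) as Hna
    by (intros a x Hx N A; apply N; eauto).
  assert (forall x, X x x -> Y (g x) (g x) /\
    forall n, atleast (X x) n -> atleast (Y (g x)) n) as Hg.
  { intros x Hx. unfold g.
    destruct (table_spec X L x (u (m x))) as [[a [b [I [A ->]]]]|[N ->]].
    - destruct (HL a b I) as [H1 H2]. split; [exact H1|].
      intros n Hn. apply H2. eapply atleast_ext; [|exact Hn].
      intros i. symmetry. now apply per_row.
    - pose proof (Hm x Hx) as A. destruct (Hu (m x)) as [H1 [_ H2]].
      + eapply per_refl_r; eauto.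
      + intros a b I. apply Hna; eauto.
      + split; [exact H1|]. intros n Hn. apply H2.
        eapply atleast_ext; [|exact Hn]. now apply per_row. }
  assert (forall x x', X x x -> X x' x' -> (X x x' <-> Y (g x) (g x'))) as Hgg.
  { intros x x' Hx Hx'. split; intros H.
    - replace (g x') with (g x); [now apply Hg|]. unfold g.
      rewrite <- (Hmm x x' H). generalize (u (m x)) as d. intros d.
      clear -H HX. induction L as [|[a b] L IH]; simpl; [reflexivity|].
      replace (X a x') with (X a x); [destruct (X a x); auto|].
      apply eq_true_iff_eq. destruct HX as [s t]. split; intros A.
      + apply (t _ _ _ A H).
      + apply (t _ _ _ A), s, H.
    - unfold g in H.
      destruct (table_spec X L x (u (m x))) as [[a [b [I [A E]]]]|[N E]];
      destruct (table_spec X L x' (u (m x'))) as [[a' [b' [I' [A' E']]]]|[N' E']];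
      rewrite E, E' in H.
      + apply (HLL _ _ _ _ I I') in H. apply tX with a; [auto|].
        apply tX with a'; auto.
      + destruct (Hu (m x')) as [_ [H' _]].
        * eapply per_refl_r; eauto.
        * intros c d J. apply Hna; eauto.
        * destruct (H' a b I H).
      + destruct (Hu (m x)) as [_ [H' _]].
        * eapply per_refl_r; eauto.
        * intros c d J. apply Hna; eauto.
        * destruct (H' a' b' I'). auto.
      + apply Huu in H.
        * apply tX with (m x); [auto|]. rewrite H. auto.
        * eapply per_refl_r; eauto.
        * eapply per_refl_r; eauto.
        * intros c d J. apply Hna; eauto.
        * intros c d J. apply Hna; eauto. }
  assert (forall x, exists y, X x x -> Y (g x) y /\ count (Y (g x)) y = count (X x) x)
    as Hex.
  { intros x. destruct (classic (X x x)) as [Hx|Hx]; [|exists 0; contradiction].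
    destruct (Hg x Hx) as [_ H].
    (* With [x] itself, the class of [x] has more than [count (X x) x] elements, so the target class
       contains one of that rank. *)
    destruct (H (S (count (X x) x))) as [N HN].
    - exists (S x). rewrite count_S by exact Hx. lia.
    - destruct (count_nth _ _ _ HN) as [y Hy]. eauto. }
  assert (exists F, (computable1 u -> computable1 F) /\
    forall x, X x x -> Y (g x) (F x) /\ count (Y (g x)) (F x) = count (X x) x)
    as [F [CF HF]].
  (* If [u] is computable, a search provides [F]; otherwise choice does. *)
  { destruct (classic (computable1 u)) as [Cu|Cu].
    - assert (computable1 g) as Cg.
      { apply computable1_comp. apply comp_table; [exact dX|apply (comp_var 0); lia|].
        apply (comp_app1 u _ _ Cu), (comp_app1 m _ _ Cm), (comp_var 0); lia. }
      destruct (comp_mu 1 (fun y v => X (hd 0 v) (hd 0 v) ->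
        Y (g (hd 0 v)) y /\ count (Y (g (hd 0 v))) y = count (X (hd 0 v)) (hd 0 v)))
        as [F [CF HF]].
      + assert (forall n a, comp n a -> comp n (fun v => g (a v))) as Cg'
          by (intros; now apply (comp_app1 g)).
        apply decp_imp; [|apply decp_and; [|apply decp_eq]].
        * apply (decp_app2 _ _ _ _ dX); apply (comp_var 1); lia.
        * apply (decp_app2 _ _ _ _ dY); [apply Cg'; apply (comp_var 1); lia|].
          apply (comp_var 0); lia.
        * apply (comp_count 2 (fun i v => Y (g (hd 0 (tl v))) i));
            [|apply (comp_var 0); lia].
          apply (decp_app2 _ _ _ _ dY); [|apply (comp_var 0); lia].
          apply Cg'; apply (comp_var 2); lia.
        * apply (comp_count 2 (fun i v => X (hd 0 (tl v)) i));
            [|apply (comp_var 1); lia].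
          apply (decp_app2 _ _ _ _ dX); [apply (comp_var 2); lia|].
          apply (comp_var 0); lia.
      + intros v _. apply Hex.
      + exists (fun x => F [x]). split.
        * intros _. apply computable1_comp, comp_ext with (2 := CF).
          intros [|x [|]] E; try discriminate. reflexivity.
        * intros x. apply (HF [x] eq_refl).
    - exists (fun x => proj1_sig (constructive_indefinite_description _ (Hex x))).
      split; [contradiction|]. intros x.
      now destruct (constructive_indefinite_description _ (Hex x)). }
  exists F. split; [|exact CF].
  assert (forall x, X x x -> Y (g x) (F x)) as HgF by (intros; now apply HF).
  split; [|split].
  - intros x Hx. eapply per_refl_r; [exact HY|apply HgF, Hx].
  - intros x x' Hx Hx' E. destruct (HF x Hx) as [H1 H2], (HF x' Hx') as [H1' H2'].
    rewrite <- E in H1', H2'.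
    assert (Y (g x) (g x')) as A by eauto.
    rewrite (count_ext _ _ _ (per_row _ _ _ HY A)), H2' in H2.
    apply Hgg in A; auto.
    rewrite (count_ext _ _ _ (per_row _ _ _ HX A)) in H2.
    symmetry. apply (count_inj (X x')); auto.
  - intros x x' Hx Hx'. rewrite Hgg by assumption.
    split; intros A; eauto 6.
Qed.

(** Recursive choice: [hist n] lists the values before stage [n], and the next one avoids their
    classes. *)
Lemma choose_unrelated (B : nat -> Prop) (A : nat -> nat -> Prop)
    (R : nat -> nat -> bool) :
  (forall i, B i -> forall l, exists y, A i y /\ forall z, In z l -> ~ R z y) ->
  exists u, (forall i, B i -> A i (u i)) /\
    forall i j, i < j -> B j -> ~ R (u i) (u j).
Proof.
  intros H.
  assert (forall i l, exists y, B i -> A i y /\ forall z, In z l -> ~ R z y) as H'.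
  { intros i l. destruct (classic (B i)) as [Bi|N]; [|exists 0; contradiction].
    destruct (H i Bi l) as [y Hy]. eauto. }
  set (c := fun i l => proj1_sig (constructive_indefinite_description _ (H' i l))).
  assert (forall i l, B i -> A i (c i l) /\ forall z, In z l -> ~ R z (c i l)) as Hc.
  { intros i l. unfold c.
    now destruct (constructive_indefinite_description _ (H' i l)). }
  set (hist := fix hist n := match n with 0 => [] | S n => c n (hist n) :: hist n end).
  exists (fun i => c i (hist i)). split; [intros; now apply Hc|].
  intros i j L Bj. apply Hc; [exact Bj|]. clear Bj. induction L; simpl; auto.
Qed.

(** Used for bi-embeddability with no claim of computability: [r] infinite classes of [Y] are
    matched by a table, and every other class of [X] receives a fresh target in turn. *)
Lemma embedding_exists X Y r ax ay :
  per X -> per Y -> decrel2 X -> decrel2 Y ->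
  (forall i, i < r -> X (ax i) (ax i)) ->
  (forall i j, i < r -> j < r -> (X (ax i) (ax j) <-> Y (ay i) (ay j))) ->
  (forall i n, i < r -> atleast (Y (ay i)) n) ->
  (forall x, X x x -> (forall i, i < r -> ~ X (ax i) x) -> forall l, exists y,
    Y y y /\ (forall z, In z l -> ~ Y z y) /\
    forall n, atleast (X x) n -> atleast (Y y) n) ->
  exists F, pemb X Y F.
Proof.
  intros HX HY dX dY Hax Hxy Hay Hfin.
  set (L := map (fun i => (ax i, ay i)) (seq 0 r)).
  assert (forall a b, In (a, b) L -> exists i, i < r /\ a = ax i /\ b = ay i) as HL.
  { intros a b I. apply in_map_iff in I as [i [E I]]. injection E as <- <-.
    apply in_seq in I. exists i. split; [lia|auto]. }
  assert (forall i, i < r -> In (ax i, ay i) L) as HL'.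
  { intros i Hi. apply in_map_iff. exists i. split; [auto|]. apply in_seq. lia. }
  destruct (choose_unrelated (fun x => X x x /\ forall i, i < r -> ~ X (ax i) x)
    (fun x y => Y y y /\ (forall i, i < r -> ~ Y (ay i) y) /\
      forall n, atleast (X x) n -> atleast (Y y) n) Y) as [u [Hu Huu]].
  { intros x [Hx Nx] l.
    destruct (Hfin x Hx Nx (l ++ map ay (seq 0 r))) as [y [Hy [Hl Hn]]].
    exists y. split; [split; [exact Hy|split; [|exact Hn]]|].
    - intros i Hi. apply Hl, in_or_app. right. apply in_map, in_seq. lia.
    - intros z Hz. apply Hl, in_or_app. auto. }
  destruct (embedding_of_classes X Y L u) as [F [HF _]]; auto.
  - intros a b I. apply HL in I as [i [Hi [-> ->]]]. split; [|auto].
    apply Hxy; auto.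
  - intros a b a' b' I I'. apply HL in I as [i [Hi [-> ->]]].
    apply HL in I' as [j [Hj [-> ->]]]. auto.
  - intros x Hx N. destruct (Hu x) as [H1 [H2 H3]].
    + split; [exact Hx|]. intros i Hi. eapply N, HL', Hi.
    + split; [exact H1|split; [|exact H3]]. intros a b I.
      apply HL in I as [i [Hi [-> ->]]]. auto.
  - intros x x' Hx Hx' N N' A.
    destruct (lt_eq_lt_dec x x') as [[H|H]|H]; [|exact H|].
    + apply Huu in H; [contradiction|].
      split; [exact Hx'|]. intros i Hi. eapply N', HL', Hi.
    + apply Huu in H; [destruct H; now apply HY|].
      split; [exact Hx|]. intros i Hi. eapply N, HL', Hi.
  - eauto.
Qed.

(** * Thin structures *)

(** Thinness: [L] meets every class with more than [k] elements. It may also have entries outside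
    the domain. *)
Definition few (X : nat -> nat -> bool) (k : nat) (L : list nat) : Prop :=
  forall x, X x x -> atleast (X x) (S k) -> exists a, In a L /\ X a x.

(** At most one class is sent into the class of a given [b], so one preimage per entry of [L]
    suffices. *)
Lemma pull_list X Y F L :
  per Y -> pemb X Y F ->
  exists L', forall x b, X x x -> In b L -> Y b (F x) -> exists a, In a L' /\ X a x.
Proof.
  intros [sY tY] [H1 [H2 H3]]. induction L as [|b L [L' IH]].
  - exists []. intros x b _ [].
  - destruct (classic (exists a, X a a /\ Y b (F a))) as [[a [Ha Hb]]|N].
    + exists (a :: L'). intros x c Hx [<-|I] Hc.
      * exists a. split; [now left|]. apply H3; eauto 6.
      * destruct (IH x c Hx I Hc) as [a' [I' H']]. exists a'. split; [now right|auto].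
    + exists L'. intros x c Hx [<-|I] Hc; [|eauto]. destruct N. eauto.
Qed.

Lemma few_pull X Y F k L :
  per X -> per Y -> pemb X Y F -> few Y k L -> exists L', few X k L'.
Proof.
  intros HX HY HF HL. destruct (pull_list X Y F L HY HF) as [L' H].
  exists L'. intros x Hx A. destruct (HL (F x)) as [b [I Hb]].
  - now apply HF.
  - now apply (pemb_atleast X Y F).
  - eauto.
Qed.

Lemma decp_unrelated (Y : nat -> nat -> bool) l :
  decrel2 Y -> decp 1 (fun v => forall b, In b l -> ~ Y b (hd 0 v)).
Proof.
  intros dY. induction l as [|b l IH].
  - apply decp_ext with (2 := decp_le 1 _ _ (comp_const 1 0) (comp_const 1 0)).
    intros v _. split; [intros _ b []|lia].
  - apply decp_ext with (2 := decp_and _ _ _ (decp_not _ _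
      (decp_app2 _ _ _ _ dY (comp_const 1 b) (comp_var 0 1 ltac:(lia)))) IH).
    intros v _. simpl. split; [|auto].
    intros [H1 H2] c [<-|I]; auto.
Qed.

Lemma computable_embedding_of_few X Y F k L :
  per X -> per Y -> decrel2 X -> decrel2 Y -> pemb X Y F -> few X k L ->
  exists F', computable1 F' /\ pemb X Y F'.
Proof.
  intros HX HY dX dY HF HL.
  destruct (least_number (fun k => exists L, few X k L)) as [k' [[L' HL'] Hmin]];
    [eauto|]. clear k L HL. rename k' into k, L' into L, HL' into HL.
  (* Entries outside the domain are dropped, since nothing is known of [F] there. *)
  pose proof HF as [HF1 [_ HF3]]. set (L0 := filter (fun a => X a a) L).
  assert (forall a, In a L0 -> X a a) as HL0 by (intros a I; now apply filter_In in I).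
  assert (forall x, X x x -> (forall a, In a L0 -> ~ X a x) -> ~ atleast (X x) (S k))
    as Hsmall.
  { intros x Hx N A. destruct (HL x Hx A) as [a [I Ha]]. apply (N a); [|exact Ha].
    apply filter_In. split; [exact I|]. eapply per_refl_l; eauto. }
  assert (exists u, computable1 u /\
    (forall x, X x x -> (forall a, In a L0 -> ~ X a x) ->
      Y (u x) (u x) /\ (forall a, In a L0 -> ~ Y (F a) (u x)) /\
      forall n, atleast (X x) n -> atleast (Y (u x)) n) /\
    (forall x x', X x x -> X x' x' -> (forall a, In a L0 -> ~ X a x) ->
      Y (u x) (u x') -> x = x')) as [u [Cu [Hu Huu]]].
  { destruct k as [|j].
    (* For [k = 0] the list meets every class, and nothing is left for [u]. *)
    - assert (forall x, X x x -> (forall a, In a L0 -> ~ X a x) -> False) as C.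
      { intros x Hx N. apply (Hsmall x Hx N). exists (S x).
        apply count_S in Hx. lia. }
      exists (fun _ => 0). split; [apply computable1_const|].
      split; intros; exfalso; eauto.
    (* Ranks start at 0, so rank [j = k - 1] picks one element from each class of size at least [k];
       the targets of the table are excluded. *)
    - destruct (dec_infinite_enum (fun y => Y y y /\ count (Y y) y = j /\
        forall b, In b (map F L0) -> ~ Y b y)) as [u [Cu [Hu Hinj]]].
      + apply decp_and; [|apply decp_and].
        * apply (decp_app2 _ _ _ _ dY); apply (comp_var 0); lia.
        * apply decp_eq; [|apply comp_const].
          apply (comp_count 1 (fun i v => Y (hd 0 v) i)); [|apply (comp_var 0); lia].
          apply (decp_app2 _ _ _ _ dY); [apply (comp_var 1)|apply (comp_var 0)]; lia.
        * now apply decp_unrelated.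
      (* Avoiding the classes of all numbers below [N] forces the new element to be at least [N].
         Minimality of [k] supplies a class of [X] whose image avoids them. *)
      + intros N. destruct (pull_list X Y F (map F L0 ++ seq 0 N) HY HF) as [L' HL'].
        assert (exists x, X x x /\ atleast (X x) (S j) /\
          forall a, In a L' -> ~ X a x) as [x [Hx [Ax Nx]]].
        { apply NNPP. intros C. apply (Hmin j); [lia|]. exists L'.
          intros x Hx A. apply NNPP. intros C'. apply C. exists x.
          split; [auto|split; [auto|]]. intros a I Ha. eauto. }
        apply (pemb_atleast X Y F) in Ax as [M HM]; auto.
        destruct (count_nth (Y (F x)) j M) as [y [Hy Cy]]; [lia|].
        assert (forall b, In b (map F L0 ++ seq 0 N) -> ~ Y b y) as Nb.
        { intros b I Hb. destruct (HL' x b Hx I) as [a [I' Ha]].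
          - destruct HY as [s t]. eauto.
          - destruct (Nx a I' Ha). }
        exists y. split; [|split; [|split]].
        * apply NNPP. intros C. apply (Nb y); [apply in_or_app; right; apply in_seq; lia|].
          eapply per_refl_r; eauto.
        * eapply per_refl_r; eauto.
        * rewrite <- Cy. apply count_ext. intros i. symmetry. now apply per_row.
        * intros b I. apply Nb, in_or_app. auto.
      + exists u. split; [exact Cu|split].
        * intros x Hx N. destruct (Hu x) as [H1 [H2 H3]].
          split; [exact H1|split].
          { intros a I. apply H3, in_map, I. }
          (* Off the table the class of [x] has at most [j + 1] elements, and the rank of [u x]
             exhibits [j + 1] in its own class. *)
          intros n An. exists (S (u x)). rewrite count_S by exact H1.
          rewrite H2. apply NNPP. intros C. apply (Hsmall x Hx N).
          apply atleast_le with (2 := An). lia.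
        * intros x x' _ _ _ A. apply Hinj.
          destruct (Hu x) as [H1 [H2 _]], (Hu x') as [H1' [H2' _]].
          apply (count_inj (Y (u x))); auto.
          rewrite (count_ext _ _ (u x') (per_row _ _ _ HY A)). congruence. }
  destruct (embedding_of_classes X Y (map (fun a => (a, F a)) L0) u) as [F' [E C]];
    auto.
  - intros a b I. apply in_map_iff in I as [a' [E I]]. injection E as <- <-.
    split; [apply HF1, HL0, I|]. intros n. apply (pemb_atleast X Y F); auto.
  - intros a b a' b' I I'. apply in_map_iff in I as [c [E I]]. injection E as <- <-.
    apply in_map_iff in I' as [c' [E I']]. injection E as <- <-. apply HF3; auto.
  - intros x Hx N. destruct (Hu x Hx) as [H1 [H2 H3]].
    + intros a I. apply (N a (F a)), in_map_iff. eauto.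
    + split; [auto|split; [|auto]]. intros a b I.
      apply in_map_iff in I as [c [E I]]. injection E as <- <-. auto.
  - intros x x' Hx Hx' N _. apply Huu; auto.
    intros a I. apply (N a (F a)), in_map_iff. eauto.
  - eauto.
Qed.

(** * Computable equivalence structures *)

Definition represents (S : structure) (X : nat -> nat -> bool) : Prop :=
  per X /\ decrel2 X /\ (forall x, dom S x <-> X x x) /\
  forall x y, dom S x -> dom S y -> (rel S x y <-> X x y).

Lemma represents_exists S :
  is_equivalence_structure S -> computable_structure S -> exists X, represents S X.
Proof.
  intros [Hr [Hs Ht]] [[d [Cd Hd]] [e [Ce He]]].
  (* [e] is arbitrary outside the domain, so its values there are masked by [d]. *)
  destruct (decrel2_bool (fun x y => d x = 1 /\ d y = 1 /\ e x y = 1)) as [X [dX HX]].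
  - assert (forall n a, comp n a -> comp n (fun v => d (a v))) as Cd'
      by (intros; now apply (comp_app1 d)).
    assert (comp 2 (var 0)) as C0 by (apply comp_var; lia).
    assert (comp 2 (var 1)) as C1 by (apply comp_var; lia).
    apply decp_and; [|apply decp_and]; apply decp_eq; try apply comp_const.
    + apply (Cd' 2 _ C0).
    + apply (Cd' 2 _ C1).
    + apply (comp_app2 e _ _ _ Ce C0 C1).
  - assert (forall x y, X x y <-> dom S x /\ dom S y /\ rel S x y) as HX'.
    { intros x y. rewrite HX, (Hd x), (Hd y). split; intros [H1 [H2 H3]];
        (split; [exact H1|split; [exact H2|]]); apply He; auto; now apply Hd. }
    exists X. split; [split|split; [exact dX|split]].
    + intros x y H. rewrite HX' in *. intuition.
    + intros x y z H H'. rewrite HX' in *. intuition. eauto.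
    + intros x. rewrite HX'. split; [auto|tauto].
    + intros x y Hx Hy. rewrite HX'. tauto.
Qed.

Definition of_per (X : nat -> nat -> bool) : structure :=
  Struct (fun x => X x x) (fun x y => X x y).

Lemma of_per_spec X :
  per X -> decrel2 X ->
  is_equivalence_structure (of_per X) /\ computable_structure (of_per X) /\
  represents (of_per X) X.
Proof.
  intros HX dX. destruct (HX) as [Hs Ht].
  assert (forall b : bool, b <-> Nat.b2n b = 1) as Hb
    by (intros []; simpl; unfold is_true; split; congruence).
  split; [|split].
  - split; [|split]; simpl; eauto.
  - split.
    + exists (fun x => Nat.b2n (X x x)). split; [|intros; apply Hb].
      apply computable1_comp, comp_b2n, (decp_app2 _ _ _ _ dX);
        apply (comp_var 0); lia.
    + exists (fun x y => Nat.b2n (X x y)). split; [|intros; apply Hb].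
      apply computable2_comp, comp_b2n. exact dX.
  - split; [exact HX|split; [exact dX|]]. simpl. split; tauto.
Qed.

Lemma embedding_pemb S T X Y F :
  represents S X -> represents T Y -> (is_embedding S T F <-> pemb X Y F).
Proof.
  intros [_ [_ [dX rX]]] [_ [_ [dY rY]]].
  split; intros [H1 [H2 H3]]; (split; [|split]).
  - intros x Hx. apply dY, H1, dX, Hx.
  - intros x x' Hx Hx'. apply H2; now apply dX.
  - intros x x' Hx Hx'. apply dX in Hx, Hx'. rewrite <- rX, H3 by assumption.
    apply rY; auto.
  - intros x Hx. apply dY, H1, dX, Hx.
  - intros x x' Hx Hx'. apply H2; now apply dX.
  - intros x x' Hx Hx'. rewrite rX, rY by (try apply dY, H1, dX; assumption).
    apply H3; now apply dX.
Qed.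

Lemma class_size_le_iff S X x k :
  represents S X -> dom S x -> (class_size_le S x k <-> ~ atleast (X x) (Datatypes.S k)).
Proof.
  intros [HX [_ [dX rX]]] Hx.
  assert (forall y, eclass S x y <-> X x y) as E.
  { intros y. unfold eclass. split.
    - intros [Hy H]. now apply rX.
    - intros H. assert (dom S y) by (apply dX; eapply per_refl_r; eauto).
      split; [|apply rX]; auto. }
  split.
  - intros [l [Ll Hl]] [N HN]. rewrite count_filter in HN.
    enough (length (filter (X x) (seq 0 N)) <= length l) by lia.
    apply NoDup_incl_length; [apply NoDup_filter, seq_NoDup|].
    intros y Hy. apply filter_In in Hy as [_ Hy]. now apply Hl, E.
  - intros A. destruct (not_atleast_bound _ _ A) as [N HN].
    exists (filter (X x) (seq 0 N)). split.
    + rewrite <- count_filter. apply NNPP. intros C. apply A. exists N. lia.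
    + intros y Hy. apply E in Hy. apply filter_In. split; [|exact Hy].
      apply in_seq. apply HN in Hy. lia.
Qed.

Lemma finite_class_iff S X x :
  represents S X -> dom S x -> (finite_class S x <-> exists k, ~ atleast (X x) k).
Proof.
  intros HX Hx. split.
  - intros [l Hl]. exists (Datatypes.S (length l)). apply (class_size_le_iff S); auto.
    now exists l.
  - intros [k Hk]. assert (~ atleast (X x) (Datatypes.S k)) as A.
    { intros A. apply Hk. apply atleast_le with (2 := A). lia. }
    apply (class_size_le_iff S) in A as [l [_ Hl]]; auto. now exists l.
Qed.

Lemma few_iff S X :
  represents S X ->
  (finitely_many_infinite_classes S /\ bounded_character S <->
   exists k L, few X k L).
Proof.
  intros HX. pose proof HX as [pX [_ [dX rX]]]. split.
  - intros [[L HL] [k Hk]]. exists k, L. intros x Hx A. apply dX in Hx.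
    destruct (HL x Hx) as [r [Hr [Dr Rr]]].
    + intros Hfin. apply (Hk x Hx) in Hfin.
      apply (class_size_le_iff S X) in Hfin; auto.
    + exists r. split; [auto|]. now apply rX.
  - intros [k [L HL]]. split.
    + exists L. intros x Hx Hinf. destruct (HL x) as [a [I Ha]].
      * now apply dX.
      * apply NNPP. intros C. apply Hinf, (finite_class_iff S X); eauto.
      * assert (dom S a) as Da by (apply dX; eapply per_refl_l; eauto).
        exists a. split; [auto|split; [auto|]]. now apply rX.
    (* [K] exceeds the sizes of the finite classes that meet [L]; the classes that miss [L] have at
       most [k] elements. *)
    + assert (exists K, forall a x, In a L -> X a x -> finite_class S x ->
        ~ atleast (X x) K) as [K HK].
      { clear HL. induction L as [|a L [K HK]].
        - exists 0. intros a x [].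
        - destruct (classic (exists x, X a x /\ finite_class S x)) as [[y [Hy Fy]]|N].
          + apply (finite_class_iff S X) in Fy as [K' HK']; auto.
            2: { apply dX. eapply per_refl_r; eauto. }
            exists (K + K'). intros b x [<-|I] Hx Fx A.
            * apply HK'. apply atleast_le with (n := K + K'); [lia|].
              eapply atleast_ext; [|exact A]. intros i. apply per_row; auto.
              destruct pX as [s t]. eauto.
            * apply (HK b x I Hx Fx). apply atleast_le with (2 := A). lia.
          + exists K. intros b x [<-|I] Hx Fx; [destruct N; eauto|].
            apply (HK b x I Hx Fx). }
      exists (k + K). intros x Hx Fx. apply (class_size_le_iff S X); auto. intros A.
      destruct (HL x) as [a [I Ha]].
      * now apply dX.
      * apply atleast_le with (2 := A). lia.
      * apply (HK a x I Ha Fx). apply atleast_le with (2 := A). lia.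
Qed.

Lemma pemb_comp X Y Z F G :
  pemb X Y F -> pemb Y Z G -> pemb X Z (fun x => G (F x)).
Proof.
  intros [F1 [F2 F3]] [G1 [G2 G3]]. split; [|split].
  - auto.
  - intros x x' Hx Hx' E. apply F2; auto.
  - intros x x' Hx Hx'. rewrite F3, G3 by auto. reflexivity.
Qed.

Lemma categorical_computable_embedding S X B C :
  computably_bi_embeddably_categorical S -> represents S X ->
  per B -> decrel2 B -> per C -> decrel2 C ->
  (exists F, pemb X B F) -> (exists F, pemb B X F) ->
  (exists F, pemb X C F) -> (exists F, pemb C X F) ->
  exists F, computable1 F /\ pemb B C F.
Proof.
  intros HS HX pB dB pC dC XB BX XC CX.
  assert (forall Y, per Y -> decrel2 Y -> (exists F, pemb X Y F) ->
    (exists F, pemb Y X F) -> (exists F, computable1 F /\ pemb X Y F) /\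
    exists F, computable1 F /\ pemb Y X F) as A.
  { intros Y pY dY [F HF] [G HG]. destruct (of_per_spec Y pY dY) as [H1 [H2 H3]].
    destruct (HS (of_per Y) H2 H1) as [[F' [CF HF']] [G' [CG HG']]].
    - split.
      + exists F. now apply (embedding_pemb _ _ _ _ _ HX H3).
      + exists G. now apply (embedding_pemb _ _ _ _ _ H3 HX).
    - apply (embedding_pemb _ _ _ _ _ HX H3) in HF'.
      apply (embedding_pemb _ _ _ _ _ H3 HX) in HG'.
      split; [now exists F'|now exists G']. }
  destruct (A B pB dB XB BX) as [_ [G [CG HG]]].
  destruct (A C pC dC XC CX) as [[F [CF HF]] _].
  exists (fun x => F (G x)). split; [|eapply pemb_comp; eauto].
  apply computable1_comp, (comp_app1 F _ _ CF), (comp_app1 G _ _ CG), (comp_var 0). lia.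
Qed.

(** * Structures that do not embed computably *)

Lemma pigeonhole (phi : nat -> nat) r :
  (forall i, i <= r -> phi i < r) -> exists i j, i < j /\ j <= r /\ phi i = phi j.
Proof.
  intros H. apply NNPP. intros C.
  enough (length (map phi (seq 0 (S r))) <= length (seq 0 r))
    by (rewrite length_map, !length_seq in *; lia).
  apply NoDup_incl_length.
  - apply NoDup_map_NoDup_ForallPairs; [|apply seq_NoDup].
    intros i j Hi Hj E. apply in_seq in Hi, Hj.
    destruct (lt_eq_lt_dec i j) as [[L|L]|L]; [|exact L|]; destruct C.
    + exists i, j. split; [exact L|split; [lia|exact E]].
    + exists j, i. split; [exact L|split; [lia|congruence]].
  - intros y Hy. apply in_map_iff in Hy as [i [<- Hi]]. apply in_seq in Hi.
    apply in_seq. specialize (H i). lia.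
Qed.

Ltac dec_atom ::=
  first [ apply (comp_app1 left _ _ computable1_left)
        | apply (comp_app1 right _ _ computable1_right)
        | apply dec_halts ].

Definition first_at (P : nat -> nat -> Prop) (e s : nat) : Prop :=
  P e s /\ forall s', s' < s -> ~ P e s'.

Lemma first_at_unique P e s s' : first_at P e s -> first_at P e s' -> s = s'.
Proof.
  intros [H1 H2] [H1' H2']. destruct (lt_eq_lt_dec s s') as [[L|L]|L]; [|exact L|].
  - destruct (H2' s L H1).
  - destruct (H2 s' L H1').
Qed.

Lemma first_at_exists (P : nat -> nat -> Prop) e s :
  P e s -> exists s', first_at P e s'.
Proof. intros H. apply (least_number (P e)). eauto. Qed.

(* Post's simple set: the [e]-th function puts into it the first value above
   [2 * e] that it is seen to take. [W j t]: [j] has been put in before [t]. *)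
Lemma simple_set_exists :
  exists W : nat -> nat -> Prop, decrel2 W /\
    (forall j t t', t <= t' -> W j t -> W j t') /\
    (forall h, computable1 h -> (forall x y, h x = h y -> x = y) ->
      exists x t, W (h x) t) /\
    (forall N, exists j, N <= j /\ forall t, ~ W j t).
Proof.
  (* A stage [s] codes an input, a value and a certificate. *)
  set (value s := left (right s)).
  set (P := fun e s => 2 * e < value s /\ halts e (left s) (value s) (right (right s))).
  exists (fun j t => exists e, e < j /\ exists s, s < t /\ first_at P e s /\ value s = j).
  split; [|split; [|split]].
  - unfold decrel2, first_at, P, value. dec.
  - intros j t t' L [e [He [s [Hs H]]]]. exists e. split; [exact He|].
    exists s. split; [lia|exact H].
  - intros h Ch Ih. destruct (halts_computable h Ch) as [e He].
    (* By injectivity, [2 * e + 2] arguments cannot all have values up to [2 * e]. *)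
    assert (exists x, 2 * e < h x) as [x Hx].
    { apply NNPP. intros C. destruct (pigeonhole h (S (2 * e))) as [i [j [L [_ E]]]].
      - intros i _. apply NNPP. intros C'. apply C. exists i. lia.
      - apply Ih in E. lia. }
    destruct (proj2 (He x (h x)) eq_refl) as [D HD].
    destruct (first_at_exists P e (cpair x (cpair (h x) D))) as [s Hs].
    { unfold P, value. now rewrite !right_cpair, !left_cpair. }
    assert (value s = h (left s)) as E.
    { apply He. exists (right (right s)). apply Hs. }
    exists (left s), (S s), e. pose proof Hs as [[H1 _] _].
    split; [lia|]. exists s. auto.
  - intros N. apply NNPP. intros C.
    (* If all of the [N + 1] numbers from [N] to [2 * N] were put in, the threshold [2 * e] would
       make every responsible [e] smaller than [N]; but each [e] contributes only one number. *)
    assert (forall i, exists e, i <= N -> e < N /\ exists s, first_at P e s /\ value s = N + i)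
      as H.
    { intros i. destruct (classic (exists t e, e < N + i /\ exists s, s < t /\
        first_at P e s /\ value s = N + i)) as [[t [e [He [s [_ [Hs E]]]]]]|A].
      - exists e. intros Hi. split; [|eauto]. pose proof Hs as [[H1 _] _]. lia.
      - destruct C. exists (N + i). split; [lia|]. intros t H. eauto. }
    set (phi i := proj1_sig (constructive_indefinite_description _ (H i))).
    assert (forall i, i <= N -> phi i < N /\
      exists s, first_at P (phi i) s /\ value s = N + i) as Hphi.
    { intros i. unfold phi.
      now destruct (constructive_indefinite_description _ (H i)). }
    destruct (pigeonhole phi N) as [i [j [L [L' E]]]]; [intros; now apply Hphi|].
    destruct (Hphi i) as [_ [s [Hs Es]]]; [lia|].
    destruct (Hphi j) as [_ [s' [Hs' Es']]]; [lia|].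
    rewrite E in Hs. rewrite (first_at_unique _ _ _ _ Hs Hs') in Es. lia.
Qed.

(* Fiber [e] is [0..e] together with [h e + 1] further elements, placed after
   the least certificate for [h e], where [h] is the [e]-th function. *)
Lemma fast_fibers_exist :
  exists V : nat -> nat -> Prop, decrel2 V /\
    (forall e s, s <= e -> V e s) /\
    (forall e, exists N, forall s, V e s -> s < N) /\
    (forall h, computable1 h -> exists e a, forall i, i < S (h e) -> V e (a + i)).
Proof.
  (* Here a stage codes a value and a certificate, and the [e]-th function is run on [e] itself. *)
  set (P := fun e s => halts e e (left s) (right s)).
  exists (fun e s => s <= e \/
    exists t, t < s /\ first_at P e t /\ s <= t + S (left t)).
  split; [|split; [|split]].
  - unfold decrel2, first_at, P. dec.
  - auto.
  - intros e. destruct (classic (exists t, first_at P e t)) as [[t Ht]|C].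
    + exists (S (e + t + S (left t))). intros s [H|[t' [_ [Ht' H]]]]; [lia|].
      rewrite (first_at_unique _ _ _ _ Ht Ht'). lia.
    + exists (S e). intros s [H|[t' [_ [Ht' _]]]]; [lia|]. destruct C. eauto.
  - intros h Ch. destruct (halts_computable h Ch) as [e He].
    destruct (proj2 (He e (h e)) eq_refl) as [D HD].
    destruct (first_at_exists P e (cpair (h e) D)) as [t Ht].
    { unfold P. now rewrite right_cpair, left_cpair. }
    assert (left t = h e) as E by (apply He; exists (right t); apply Ht).
    exists e, (S t). intros i Hi. right. exists t. split; [lia|].
    split; [exact Ht|lia].
Qed.

(** * Structures given by the fibers of a relation *)

(** The disjoint union of the fibers of [D], each one a class: the element [s] of fiber [i] is coded
    as [cpair i s]. *)
Definition fib (D : nat -> nat -> bool) (p q : nat) : bool :=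
  (left p =? left q) && D (left p) (right p) && D (left q) (right q).

Lemma fib_iff (D : nat -> nat -> bool) p q :
  fib D p q <-> left p = left q /\ D (left p) (right p) /\ D (left q) (right q).
Proof.
  unfold fib, is_true. rewrite !andb_true_iff, Nat.eqb_eq. tauto.
Qed.

Lemma per_fib D : per (fib D).
Proof.
  split.
  - intros p q. rewrite !fib_iff. intuition.
  - intros p q s. rewrite !fib_iff. intuition congruence.
Qed.

Lemma decrel2_fib (D : nat -> nat -> bool) : decrel2 D -> decrel2 (fib D).
Proof.
  intros dD. apply (decp_ext 2 (fun w =>
    left (hd 0 w) = left (hd 0 (tl w)) /\ D (left (hd 0 w)) (right (hd 0 w)) /\
    D (left (hd 0 (tl w))) (right (hd 0 (tl w))))).
  - intros w _. symmetry. apply fib_iff.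
  - apply decp_and; [dec|]. apply decp_and; apply (decp_app2 _ _ _ _ dD); dec.
Qed.

Lemma fib_cpair (D : nat -> nat -> bool) i s : fib D (cpair i s) (cpair i s) <-> D i s.
Proof. rewrite fib_iff, left_cpair, right_cpair. tauto. Qed.

Lemma atleast_fib D p n : fib D p p -> (atleast (fib D p) n <-> atleast (D (left p)) n).
Proof.
  intros Hp. apply fib_iff in Hp as [_ [Hp _]]. split.
  - apply (atleast_inj_image _ _ right).
    + intros q H. apply fib_iff in H as [E [_ H]]. now rewrite E.
    + intros q q' H H' E. apply fib_iff in H as [H _]. apply fib_iff in H' as [H' _].
      rewrite <- (cpair_left_right q), <- (cpair_left_right q'). congruence.
  - apply (atleast_inj_image _ _ (cpair (left p))).
    + intros s H. apply fib_iff. rewrite left_cpair, right_cpair. auto.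
    + intros s s' _ _ E. now apply cpair_inj in E as [_ E].
Qed.

Lemma infinite_classes_embedding X Y :
  per X -> per Y -> decrel2 X -> decrel2 Y ->
  (forall l, exists y, Y y y /\ (forall z, In z l -> ~ Y z y) /\
    forall n, atleast (Y y) n) ->
  exists F, pemb X Y F.
Proof.
  intros HX HY dX dY H.
  apply (embedding_exists X Y 0 (fun _ => 0) (fun _ => 0)); auto; try (intros; lia).
  intros x _ _ l. destruct (H l) as [y [H1 [H2 H3]]]. eauto.
Qed.

Lemma fib_unrelated D l i q :
  list_max (map left l) < i -> left q = i -> forall z, In z l -> ~ fib D z q.
Proof.
  intros Hi <- z I H. apply fib_iff in H as [E _].
  apply (in_map left), in_list_max in I. lia.
Qed.

(** Fiber [j] of [C] consists of the stages at which [j] is not yet in the simple set. The class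
    indices of a computable embedding of [fib B] into [fib C] would form a computable injection
    avoiding that set. *)
Lemma not_categorical_of_infinite_classes S X :
  represents S X ->
  (forall l, exists x, X x x /\ (forall z, In z l -> ~ X z x) /\
    forall n, atleast (X x) n) ->
  ~ computably_bi_embeddably_categorical S.
Proof.
  intros HX Hinf HS. pose proof HX as [pX [dX _]].
  destruct simple_set_exists as [W [dW [Wmono [Whit Wco]]]].
  destruct (decrel2_bool (fun j t => ~ W j t)) as [C [dC HC]].
  { apply decp_not. exact dW. }
  set (B := fun _ _ : nat => true).
  assert (decrel2 B) as dB.
  { apply decp_ext with (2 := decp_eq 2 _ _ (comp_const 2 0) (comp_const 2 0)).
    intros; now split. }
  assert (forall (D : nat -> nat -> bool) N, (forall s, D N s) -> fib D (cpair N 0) (cpair N 0) /\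
    forall n, atleast (fib D (cpair N 0)) n) as Hfull.
  { intros D N H. assert (fib D (cpair N 0) (cpair N 0)) as H0 by now apply fib_cpair.
    split; [exact H0|]. intros n. apply atleast_fib; [exact H0|].
    rewrite left_cpair. apply (atleast_segment _ 0). auto. }
  assert (forall D : nat -> nat -> bool, decrel2 D ->
    (forall N, exists j, N <= j /\ forall s, D j s) ->
    (exists F, pemb X (fib D) F) /\ exists F, pemb (fib D) X F) as E.
  { intros D dD HD. split.
    - apply infinite_classes_embedding; auto using per_fib, decrel2_fib.
      intros l. destruct (HD (Datatypes.S (list_max (map left l)))) as [j [Lj Hj]].
      exists (cpair j 0). destruct (Hfull D j Hj) as [H1 H2].
      split; [exact H1|split; [|exact H2]].
      apply fib_unrelated with j; [lia|apply left_cpair].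
    - apply infinite_classes_embedding; auto using per_fib, decrel2_fib. }
  destruct (E B dB) as [XB BX]; [intros N; exists N; now split|].
  destruct (E C dC) as [XC CX].
  { intros N. destruct (Wco N) as [j [Lj Hj]]. exists j.
    split; [exact Lj|]. intros s. now apply HC. }
  destruct (categorical_computable_embedding S X (fib B) (fib C)) as [F [CF HF]];
    auto using per_fib, decrel2_fib.
  set (h i := left (F (cpair i 0))).
  destruct (Whit h) as [i [t Ht]].
  - apply computable1_comp, (comp_app1 left _ _ computable1_left), (comp_app1 F _ _ CF).
    dec.
  - intros i j Eh.
    assert (fib C (F (cpair i 0)) (F (cpair j 0))) as H.
    { apply fib_iff. split; [exact Eh|].
      split; apply (proj1 (fib_iff C _ _) (proj1 HF _ (proj2 (fib_cpair B _ 0) eq_refl))). }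
    apply HF in H; [|now apply fib_cpair|now apply fib_cpair].
    apply fib_iff in H as [H _]. now rewrite !left_cpair in H.
  (* Fiber [h i] of [C] has no element from [t] on, yet the infinite class [i] of [fib B] would
     embed into it. *)
  - destruct (Hfull B i) as [H1 H2]; [easy|].
    specialize (H2 (Datatypes.S t)).
    apply (pemb_atleast _ _ _ _ _ (per_fib B) HF H1) in H2.
    apply atleast_fib in H2; [|now apply HF].
    apply (bound_not_atleast _ t) in H2; [exact H2|].
    intros s Hs. apply NNPP. intros L. apply HC in Hs. apply Hs.
    apply Wmono with t; [lia|exact Ht].
Qed.

(** Induction on the list: an entry is kept if its class is infinite and not yet represented. *)
Lemma infinite_class_representatives X l :
  per X ->
  (forall x, X x x -> (forall n, atleast (X x) n) -> exists z, In z l /\ X z x) ->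
  exists r ax,
    (forall i, i < r -> X (ax i) (ax i) /\ forall n, atleast (X (ax i)) n) /\
    (forall i j, i < r -> j < r -> X (ax i) (ax j) -> i = j) /\
    forall x, X x x -> (forall n, atleast (X x) n) -> exists i, i < r /\ X (ax i) x.
Proof.
  intros HX Hl. pose proof HX as [sX tX].
  enough (exists r ax,
    (forall i, i < r -> X (ax i) (ax i) /\ forall n, atleast (X (ax i)) n) /\
    (forall i j, i < r -> j < r -> X (ax i) (ax j) -> i = j) /\
    forall x z, In z l -> X z x -> (forall n, atleast (X x) n) ->
      exists i, i < r /\ X (ax i) x) as [r [ax [H1 [H2 H3]]]].
  { exists r, ax. split; [exact H1|split; [exact H2|]].
    intros x Hx Ax. destruct (Hl x Hx Ax) as [z [I Hz]]. eauto. }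
  clear Hl. induction l as [|z l [r [ax [H1 [H2 H3]]]]].
  - exists 0, (fun _ => 0). split; [intros; lia|split; [intros; lia|intros x z []]].
  - destruct (classic (X z z /\ (forall n, atleast (X z) n) /\
      forall i, i < r -> ~ X (ax i) z)) as [[Hz [Az Nz]]|C].
    + exists (S r), (fun i => if i =? r then z else ax i). split; [|split].
      * intros i Hi. destruct (Nat.eqb_spec i r); [now split|apply H1; lia].
      * intros i j Hi Hj. destruct (Nat.eqb_spec i r), (Nat.eqb_spec j r); intros A.
        { congruence. }
        { destruct (Nz j); [lia|auto]. }
        { destruct (Nz i); [lia|auto]. }
        { apply H2; [lia|lia|exact A]. }
      * intros x z' [<-|I] A Ax.
        { exists r. rewrite Nat.eqb_refl. auto. }
        { destruct (H3 x z' I A Ax) as [i [Hi A']]. exists i. split; [lia|].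
          destruct (Nat.eqb_spec i r); [lia|exact A']. }
    + exists r, ax. split; [exact H1|split; [exact H2|]].
      intros x z' [<-|I] A Ax; [|eauto].
      apply NNPP. intros C'. apply C. split; [eauto|split].
      * intros n. eapply atleast_ext; [|apply Ax]. intros i.
        symmetry. now apply per_row.
      * intros i Hi A'. apply C'. eauto.
Qed.

(** Here [fib B] has the computable sizes, [i + 1] at each index [i] from [r] on, while those of
    [fib C] outgrow every computable bound. Hence the impossible embedding goes from [fib C] to
    [fib B]. *)
Lemma not_categorical_of_unbounded S X l :
  represents S X ->
  (forall x, X x x -> (forall n, atleast (X x) n) -> exists z, In z l /\ X z x) ->
  (forall k L, ~ few X k L) ->
  ~ computably_bi_embeddably_categorical S.
Proof.
  intros HX Hl Hfew HS. pose proof HX as [pX [dX _]].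
  destruct (infinite_class_representatives X l pX Hl) as [r [ax [Hax [Hinj Hcov]]]].
  destruct fast_fibers_exist as [V [dV [Vle [Vfin Vdiag]]]].
  assert (comp 2 (var 0)) as C0 by (apply comp_var; lia).
  assert (comp 2 (var 1)) as C1 by (apply comp_var; lia).
  destruct (decrel2_bool (fun i s => i < r \/ s <= i)) as [B [dB HB]]; [unfold decrel2; dec|].
  destruct (decrel2_bool (fun i s => i < r \/ V (i - r) s)) as [C [dC HC]].
  { apply decp_or; [dec|].
    apply (decp_app2 _ _ _ _ dV); [|exact C1].
    apply (comp_app2 _ _ _ _ computable2_sub C0 (comp_const 2 r)). }
  (* What makes [fib D] bi-embeddable with [X]: [r] infinite classes, followed by finite ones whose
     sizes tend to infinity. *)
  set (standard := fun D : nat -> nat -> bool =>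
    (forall i s, i < r -> D i s) /\ (forall i, D i 0) /\
    (forall i, r <= i -> exists N, forall s, D i s -> s < N) /\
    (forall i s, s + r <= i -> D i s)).
  assert (forall D, standard D -> forall i n, i < r -> atleast (fib D (cpair i 0)) n)
    as Hinf.
  { intros D [D1 [D2 _]] i n Hi. apply atleast_fib; [now apply fib_cpair|].
    rewrite left_cpair. apply (atleast_segment _ 0). auto. }
  assert (forall D, standard D -> forall p, fib D p p -> r <= left p ->
    exists k, ~ atleast (fib D p) k) as Hfin.
  { intros D [_ [_ [D3 _]]] p Hp Lp. destruct (D3 _ Lp) as [N HN]. exists (Datatypes.S N).
    rewrite atleast_fib by exact Hp. now apply bound_not_atleast. }
  assert (forall D i j, standard D -> (fib D (cpair i 0) (cpair j 0) <-> i = j)) as Hij.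
  { intros D i j [_ [D2 _]]. rewrite fib_iff, !left_cpair, !right_cpair.
    split; [tauto|]. intros ->. auto. }
  assert (forall D : nat -> nat -> bool, decrel2 D -> standard D ->
    (exists F, pemb X (fib D) F) /\ exists F, pemb (fib D) X F) as E.
  { intros D dD sD. pose proof sD as [D1 [D2 [D3 D4]]].
    assert (forall i j, i < r -> j < r -> (X (ax i) (ax j) <->
      fib D (cpair i 0) (cpair j 0))) as A.
    { intros i j Hi Hj. rewrite Hij by exact sD. split; [auto|].
      intros ->. now apply Hax. }
    split.
    - apply (embedding_exists X (fib D) r ax (fun i => cpair i 0));
        auto using per_fib, decrel2_fib; [intros; now apply Hax|].
      intros x Hx Nx L.
      assert (exists k, ~ atleast (X x) k) as [k Hk].
      { apply NNPP. intros N. destruct (Hcov x Hx) as [i [Hi A']].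
        - intros n. apply NNPP. eauto.
        - destruct (Nx i Hi A'). }
      (* The part [k + r] ensures [k] elements in fiber [j]; the rest makes its class differ from
         those of [L]. *)
      set (j := k + r + Datatypes.S (list_max (map left L))).
      exists (cpair j 0).
      assert (fib D (cpair j 0) (cpair j 0)) as Hj by now apply Hij.
      split; [exact Hj|split].
      + apply fib_unrelated with j; [lia|apply left_cpair].
      + intros n An. apply atleast_fib; [exact Hj|]. rewrite left_cpair.
        apply atleast_le with k.
        * apply NNPP. intros L'. apply Hk. apply atleast_le with (2 := An). lia.
        * apply (atleast_segment _ 0). intros i Hi. apply D4. lia.
    - apply (embedding_exists (fib D) X r (fun i => cpair i 0) ax);
        auto using per_fib, decrel2_fib.
      + intros i _. now apply Hij.
      + intros i j Hi Hj. symmetry. auto.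
      + intros i n Hi. now apply Hax.
      + intros p Hp Np L. destruct (Hfin D sD p Hp) as [k Hk].
        { apply NNPP. intros Lp. apply (Np (left p)); [lia|].
          apply fib_iff. rewrite left_cpair, right_cpair.
          apply fib_iff in Hp. split; [auto|]. split; [auto|tauto]. }
        (* Since [L] does not witness thinness, some class with more than [k] elements avoids it. *)
        assert (exists x, X x x /\ atleast (X x) (Datatypes.S k) /\
          forall z, In z L -> ~ X z x) as [x [Hx [Ax Nx]]].
        { apply NNPP. intros N. apply (Hfew k L). intros x Hx Ax.
          apply NNPP. intros N'. apply N. exists x. split; [auto|split; [auto|]].
          intros z I Hz. eauto. }
        exists x. split; [exact Hx|split; [exact Nx|]].
        intros n An. apply atleast_le with (2 := Ax).
        apply NNPP. intros L'. apply Hk. apply atleast_le with (2 := An). lia. }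
  assert (standard B) as sB.
  { split; [|split; [|split]].
    - intros i s Hi. apply HB. auto.
    - intros i. apply HB. right. lia.
    - intros i Hi. exists (Datatypes.S i). intros s Hs. apply HB in Hs. lia.
    - intros i s Hi. apply HB. right. lia. }
  assert (standard C) as sC.
  { split; [|split; [|split]].
    - intros i s Hi. apply HC. auto.
    - intros i. apply HC. right. apply Vle. lia.
    - intros i Hi. destruct (Vfin (i - r)) as [N HN]. exists N. intros s Hs.
      apply HC in Hs as [Hs|Hs]; [lia|auto].
    - intros i s Hi. apply HC. right. apply Vle. lia. }
  destruct (E B dB sB) as [XB BX]. destruct (E C dC sC) as [XC CX].
  destruct (categorical_computable_embedding S X (fib C) (fib B)) as [F [CF HF]];
    auto using per_fib, decrel2_fib.
  set (idx i := left (F (cpair i 0))).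
  assert (forall i, fib C (cpair i 0) (cpair i 0)) as Cdom by (intros; now apply Hij).
  assert (forall i, fib B (F (cpair i 0)) (F (cpair i 0))) as Bdom
    by (intros; now apply HF).
  assert (forall i j, idx i = idx j -> i = j) as idx_inj.
  { intros i j Eij. apply (Hij C i j sC). apply HF; auto. apply fib_iff.
    split; [exact Eij|].
    split; [apply (proj1 (fib_iff _ _ _) (Bdom i))|apply (proj1 (fib_iff _ _ _) (Bdom j))]. }
  assert (forall i, i < r -> idx i < r) as idx_lt.
  { intros i Hi. apply NNPP. intros L.
    destruct (Hfin B sB (F (cpair i 0)) (Bdom i)) as [k Hk]; [unfold idx in L; lia|].
    apply Hk. apply (pemb_atleast _ _ _ _ _ (per_fib C) HF (Cdom i)).
    now apply Hinf. }
  (* [F] permutes the [r] infinite classes, so it maps finite classes to finite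
     classes, whose sizes are computable in [fib B]. *)
  assert (forall i, r <= i -> r <= idx i) as idx_ge.
  { intros i Hi. apply NNPP. intros L.
    (* The argument [r] stands for [i]: otherwise [r + 1] different classes would receive different
       indices below [r]. *)
    destruct (pigeonhole (fun k => if k <? r then idx k else idx i) r)
      as [a [b [Lab [Lb Eab]]]].
    - intros k _. destruct (Nat.ltb_spec k r); [auto|lia].
    - destruct (Nat.ltb_spec a r); [|lia].
      destruct (Nat.ltb_spec b r); apply idx_inj in Eab; lia. }
  (* The extra successor gives class [i] of [fib C] at least [idx i + 2] elements, one more than
     class [idx i] of [fib B] has. *)
  destruct (Vdiag (fun e => Datatypes.S (idx (r + e)))) as [e [a Ha]].
  { apply computable1_comp, comp_succ, (comp_app1 left _ _ computable1_left),
      (comp_app1 F _ _ CF). dec. }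
  set (i := r + e) in *.
  assert (atleast (fib C (cpair i 0)) (Datatypes.S (Datatypes.S (idx i)))) as A.
  { apply atleast_fib; [apply Cdom|]. rewrite left_cpair.
    apply (atleast_segment _ a). intros s Hs. apply HC. right.
    replace (i - r) with e by lia. now apply Ha. }
  apply (pemb_atleast _ _ _ _ _ (per_fib C) HF (Cdom i)) in A.
  apply atleast_fib in A; [|apply Bdom].
  apply bound_not_atleast in A; [exact A|].
  intros s Hs. apply HB in Hs. pose proof (idx_ge i ltac:(lia)).
  unfold idx in *. lia.
Qed.

Theorem theorem2p6 (S : structure) :
  is_equivalence_structure S -> computable_structure S ->
  (computably_bi_embeddably_categorical S <->
   finitely_many_infinite_classes S /\ bounded_character S).
Proof.
  intros ES CS. destruct (represents_exists S ES CS) as [X HX].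
  pose proof HX as [pX [dX _]]. rewrite (few_iff S X HX). split.
  - intros HS. apply NNPP. intros Hfew.
    (* Either a finite list meets all infinite classes, or every finite list misses one. *)
    destruct (classic (exists l, forall x, X x x -> (forall n, atleast (X x) n) ->
      exists z, In z l /\ X z x)) as [[l Hl]|N].
    + apply (not_categorical_of_unbounded S X l HX Hl); [|exact HS].
      intros k L H. eauto.
    + apply (not_categorical_of_infinite_classes S X HX); [|exact HS].
      intros l. apply NNPP. intros C. apply N. exists l. intros x Hx Ax.
      apply NNPP. intros C'. apply C. exists x.
      split; [exact Hx|split; [|exact Ax]]. intros z I Hz. eauto.
  - intros [k [L HL]] T CT ET [[F HF] [G HG]].
    destruct (represents_exists T ET CT) as [Y HY]. pose proof HY as [pY [dY _]].
    apply (embedding_pemb S T X Y F HX HY) in HF.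
    apply (embedding_pemb T S Y X G HY HX) in HG.
    (* Thinness passes to [T] along [G], so the computable embedding can be built in both
       directions. *)
    destruct (few_pull Y X G k L pY pX HG HL) as [L' HL'].
    destruct (computable_embedding_of_few X Y F k L) as [F' [CF HF']]; auto.
    destruct (computable_embedding_of_few Y X G k L') as [G' [CG HG']]; auto.
    split; [exists F'|exists G']; split; auto; eapply embedding_pemb; eauto.
Qed.
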